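(* Let $K$ be a field and let $M$ be the Chinese monoid of rank $n\ge1$. If $P$ is a minimal prime ideal of the Chinese algebra $K[M]$, then the algebra $K[M]/P$ is semiprimitive (i.e. its Jacobson radical is zero).
   Context: The Chinese monoid of rank $n$ is the monoid $M=\langle a_1,\dots,a_n\rangle$ defined by the relations $a_ja_ia_k=a_ja_ka_i=a_ka_ja_i$ for $i\le k\le j$; the Chinese algebra $K[M]$ is its monoid algebra over $K$. *)

(* Defs.v *)
From HB Require Import structures.
From mathcomp Require Import all_boot all_order all_algebra.
From mathcomp Require Import boolp.
From mathcomp Require Import monalg.

Set Implicit Arguments.
Unset Strict Implicit.
Unset Printing Implicit Defensive.

Import GRing.Theory.

Local Open Scope ring_scope.
Local Open Scope quotient_scope.

(* The generators a_1, ..., a_n are indexed by 'I_n, and elements of the free *)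
(* monoid on them are the words of type seq 'I_n.                             *)
Section ChineseMonoid.

Variable n : nat.

Inductive chinese_cong : seq 'I_n -> seq 'I_n -> Prop :=
| chinese_jik_jki (i k j : 'I_n) :
    (i <= k)%N -> (k <= j)%N -> chinese_cong [:: j; i; k] [:: j; k; i]
| chinese_jki_kji (i k j : 'I_n) :
    (i <= k)%N -> (k <= j)%N -> chinese_cong [:: j; k; i] [:: k; j; i]
| chinese_refl u : chinese_cong u u
| chinese_sym u v : chinese_cong u v -> chinese_cong v u
| chinese_trans u v w :
    chinese_cong u v -> chinese_cong v w -> chinese_cong u w
| chinese_cat u u' v v' :
    chinese_cong u u' -> chinese_cong v v' -> chinese_cong (u ++ v) (u' ++ v').

Definition chinese_eqv (u v : seq 'I_n) : bool := `[< chinese_cong u v >].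

Fact chinese_eqv_is_equiv : equiv_class_of chinese_eqv.
Proof.
split=> [u|u v|v u w].
- exact/asboolP/chinese_refl.
- by apply/asboolP/asboolP; apply: chinese_sym.
- by move=> /asboolP uv /asboolP vw; apply/asboolP/(chinese_trans uv).
Qed.

Canonical chinese_eqv_equiv := EquivRelPack chinese_eqv_is_equiv.
Canonical chinese_eqv_encModRel := defaultEncModRel chinese_eqv.

Definition chinese_monoid := {eq_quot chinese_eqv}.

HB.instance Definition _ : EqQuotient (seq 'I_n) chinese_eqv chinese_monoid :=
  EqQuotient.on chinese_monoid.
HB.instance Definition _ := Choice.on chinese_monoid.

Definition chinese_one : chinese_monoid := \pi_chinese_monoid [::].
Definition chinese_mul (x y : chinese_monoid) : chinese_monoid :=
  \pi_chinese_monoid (repr x ++ repr y).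

Lemma chinese_piP (u v : seq 'I_n) :
  reflect (chinese_cong u v) (\pi_chinese_monoid u == \pi_chinese_monoid v).
Proof. by rewrite piE; apply: asboolP. Qed.

Lemma chinese_repr_pi (u : seq 'I_n) :
  chinese_cong (repr (\pi_chinese_monoid u)) u.
Proof. by apply/chinese_piP; rewrite reprK. Qed.

Lemma chinese_mul_pi (u v : seq 'I_n) :
  chinese_mul (\pi u) (\pi v) = \pi_chinese_monoid (u ++ v).
Proof. by apply/eqP/chinese_piP/chinese_cat; apply: chinese_repr_pi. Qed.

Lemma chinese_cong_size u v : chinese_cong u v -> size u = size v.
Proof.
elim=> //= [? ? ? _ -> _ -> //|? ? ? ? _ + _ +].
by rewrite !size_cat => -> ->.
Qed.

Fact chinese_mulA : associative chinese_mul.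
Proof.
move=> x y z; rewrite -[x]reprK -[y]reprK -[z]reprK.
by rewrite !chinese_mul_pi catA.
Qed.

Fact chinese_mul1m : left_id chinese_one chinese_mul.
Proof. by move=> x; rewrite -[x]reprK chinese_mul_pi. Qed.

Fact chinese_mulm1 : right_id chinese_one chinese_mul.
Proof. by move=> x; rewrite -[x]reprK chinese_mul_pi cats0. Qed.

Fact chinese_unitm x y :
  chinese_mul x y = chinese_one -> x = chinese_one /\ y = chinese_one.
Proof.
move=> /eqP/chinese_piP/chinese_cong_size/eqP; rewrite size_cat addn_eq0.
move=> /andP[/nilP xE /nilP yE].
by split; rewrite -[LHS]reprK ?xE ?yE.
Qed.

HB.instance Definition _ := Choice_isMonomialDef.Build chinese_monoid
  chinese_mulA chinese_mul1m chinese_mulm1 chinese_unitm.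

End ChineseMonoid.

Definition chinese_algebra (K : fieldType) (n : nat) : lalgType K :=
  {malg K[chinese_monoid n]}.

(* Subsets are boolean predicates; under the classical axioms of boolp this   *)
(* is no restriction. The ideals below need not be proper.                    *)
HB.mixin Record isTwoSided (R : pzRingType) (I : R -> bool) := {
  idealMl_subproof : forall a, {in I, forall x, a * x \in I};
  idealMr_subproof : forall a, {in I, forall x, x * a \in I}
}.

#[short(type="twosidedIdeal")]
HB.structure Definition TwoSidedIdeal (R : pzRingType) :=
  {I of GRing.ZmodClosed R I & isTwoSided R I}.

(* ring_quotient only multiplies in quotients of commutative rings; its       *)
(* additive quotient Quotient.quot is extended here to two-sided ideals of    *)
(* arbitrary rings.                                                           *)
Section QuotientRing.

Variables (R : pzRingType) (I : twosidedIdeal R).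

Definition quotient_ring := Quotient.quot (I : zmodClosed R).

HB.instance Definition _ := GRing.Zmodule.on quotient_ring.
HB.instance Definition _ : EqQuotient R (Quotient.equiv I) quotient_ring :=
  EqQuotient.on quotient_ring.

Definition quot_one : quotient_ring := \pi_quotient_ring 1.
Definition quot_mul (x y : quotient_ring) : quotient_ring :=
  \pi_quotient_ring (repr x * repr y).

Lemma quot_piP (x y : R) :
  (\pi_quotient_ring x == \pi_quotient_ring y) = (x - y \in I).
Proof. by rewrite piE. Qed.

Lemma quot_mul_pi (x y : R) :
  quot_mul (\pi x) (\pi y) = \pi_quotient_ring (x * y).
Proof.
have reprB z : repr (\pi_quotient_ring z) - z \in I by rewrite -quot_piP reprK.
apply/eqP; rewrite quot_piP.
rewrite -[_ * _](subrK (repr (\pi_quotient_ring x) * y)) -mulrBr -addrA -mulrBl.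
by rewrite rpredD //; [apply: idealMl_subproof|apply: idealMr_subproof].
Qed.

Lemma quot_add_pi (x y : R) :
  \pi_quotient_ring x + \pi_quotient_ring y = \pi_quotient_ring (x + y).
Proof. by rewrite [RHS]Quotient.pi_add. Qed.

Fact quot_mulA : associative quot_mul.
Proof.
move=> x y z; rewrite -[x]reprK -[y]reprK -[z]reprK.
by rewrite !quot_mul_pi mulrA.
Qed.

Fact quot_mul1r : left_id quot_one quot_mul.
Proof. by move=> x; rewrite -[x]reprK quot_mul_pi mul1r. Qed.

Fact quot_mulr1 : right_id quot_one quot_mul.
Proof. by move=> x; rewrite -[x]reprK quot_mul_pi mulr1. Qed.

Fact quot_mulDl : left_distributive quot_mul +%R.
Proof.
move=> x y z; rewrite -[x]reprK -[y]reprK -[z]reprK.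
by rewrite quot_add_pi !quot_mul_pi quot_add_pi mulrDl.
Qed.

Fact quot_mulDr : right_distributive quot_mul +%R.
Proof.
move=> x y z; rewrite -[x]reprK -[y]reprK -[z]reprK.
by rewrite quot_add_pi !quot_mul_pi quot_add_pi mulrDr.
Qed.

HB.instance Definition _ := GRing.Zmodule_isPzRing.Build quotient_ring
  quot_mulA quot_mul1r quot_mulr1 quot_mulDl quot_mulDr.

End QuotientRing.

Section RingNotions.

Variable R : pzRingType.

(* As P is closed under addition, I J is included in P iff all the products   *)
(* x * y with x in I and y in J lie in P.                                     *)
Definition prime_ideal (P : twosidedIdeal R) : Prop :=
  1 \notin P /\
  forall I J : twosidedIdeal R,
    (forall x y, x \in I -> y \in J -> x * y \in P) ->
    {subset I <= P} \/ {subset J <= P}.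

Definition minimal_prime_ideal (P : twosidedIdeal R) : Prop :=
  prime_ideal P /\
  forall Q : twosidedIdeal R,
    prime_ideal Q -> {subset Q <= P} -> {subset P <= Q}.

Definition left_ideal (I : {pred R}) : Prop :=
  zmod_closed I /\ forall a, {in I, forall x, a * x \in I}.

Definition maximal_left_ideal (I : {pred R}) : Prop :=
  [/\ left_ideal I, 1 \notin I &
    forall J : {pred R}, left_ideal J -> 1 \notin J ->
      {subset I <= J} -> {subset J <= I}].

Definition in_jacobson_radical (x : R) : Prop :=
  forall I : {pred R}, maximal_left_ideal I -> x \in I.

Definition semiprimitive : Prop :=
  forall x : R, in_jacobson_radical x -> x = 0.

End RingNotions.

Arguments semiprimitive R : clear implicits.

(* Main.v *)
Require Import Defs.
From mathcomp Require Import all_boot all_order all_algebra.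
From HB Require Import structures.
From mathcomp Require Import boolp classical_sets zify monalg.

(* Write R = K[M]/P, a prime ring generated by a_1, ..., a_n, and let z be the
   product a_n a_1, which is central. The proof produces a homogeneous u <> 0 in
   R such that u x u y u = u y u x u for all x and y: the corner u R u is then a
   graded commutative domain for the product uxu * uyu = uxuyu.

   The element u is found by induction on the number of letters, replacing R by
   the subring generated by the remaining letters modulo the annihilator of an
   element H that commutes with them. Put e = a_n a_1 - a_1 a_n. If e a_2 = 0,
   then z a_2 = (a_n a_2) a_1 with a_n a_2 central, so a_2 is proportional to
   a_1 and can be dropped; likewise a_(n-1) is proportional to a_n when
   a_(n-1) e = 0. Otherwise primeness forces [a_1, a_2] = 0 = [a_(n-1), a_n],
   and then F = a_(n-1) e a_2 is a nonzero element commuting with a_2, ...,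
   a_(n-1) and satisfying F a_1 = 0 = a_n F, so that F R F is spanned over the
   powers of z by F^2 times the words in the inner letters; a_1 and a_n can be
   peeled off.

   Minimality of P is only used to know that P is homogeneous for the length. If
   x is a nonzero element of the Jacobson radical, then elements of the form
   1 - u r x s u w are left invertible; taking w homogeneous of large degree and
   comparing top components in the commutative graded domain u R u gives a
   contradiction. *)

Set Implicit Arguments.
Unset Strict Implicit.
Unset Printing Implicit Defensive.

Import GRing.Theory.

Local Open Scope ring_scope.
Local Open Scope quotient_scope.

(** * Words in letters subject to the Chinese relations *)

Section Words.

Variables (R : pzRingType) (a : nat -> R).

Definition eval_word (w : seq nat) : R := \prod_(i <- w) a i.

Definition bicommutant (b : seq nat) (x : R) : Prop :=
  forall c, {in b, forall i, GRing.comm c (a i)} -> GRing.comm c x.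

Definition chinese_relations : Prop := forall i k j, (i <= k <= j)%N ->
  a j * a i * a k = a j * a k * a i /\ a j * a k * a i = a k * a j * a i.

Definition within (lo hi : nat) (w : seq nat) : bool :=
  all (fun i => lo <= i <= hi)%N w.

Lemma eval_nil : eval_word [::] = 1.
Proof. by rewrite /eval_word big_nil. Qed.

Lemma eval_cons i w : eval_word (i :: w) = a i * eval_word w.
Proof. by rewrite /eval_word big_cons. Qed.

Lemma eval_cat v w : eval_word (v ++ w) = eval_word v * eval_word w.
Proof. by rewrite /eval_word big_cat. Qed.

Lemma eval_rcons w i : eval_word (rcons w i) = eval_word w * a i.
Proof. by rewrite -cats1 eval_cat eval_cons eval_nil mulr1. Qed.

Lemma comm_eval_word c w :
  {in w, forall i, GRing.comm c (a i)} -> GRing.comm c (eval_word w).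
Proof.
elim: w => [|i w IHw] cw; first by rewrite eval_nil; apply: commr1.
rewrite eval_cons; apply: commrM; first by apply: cw; rewrite mem_head.
by apply: IHw => j jw; apply: cw; rewrite in_cons jw orbT.
Qed.

Lemma bicommutant1 b : bicommutant b 1.
Proof. by move=> c _; apply: commr1. Qed.

Lemma bicommutantM b x y :
  bicommutant b x -> bicommutant b y -> bicommutant b (x * y).
Proof. by move=> bx by_ c cb; apply: commrM; [apply: bx|apply: by_]. Qed.

Lemma bicommutantB b x y :
  bicommutant b x -> bicommutant b y -> bicommutant b (x - y).
Proof. by move=> bx by_ c cb; apply: commrB; [apply: bx|apply: by_]. Qed.

Lemma bicommutant_letter b i : i \in b -> bicommutant b (a i).
Proof. by move=> ib c; apply. Qed.

Lemma bicommutant_word b w : {subset w <= b} -> bicommutant b (eval_word w).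
Proof. by move=> wb c cb; apply: comm_eval_word => i /wb /cb. Qed.

Lemma bicommutantS b b' x :
  {subset b' <= b} -> bicommutant b' x -> bicommutant b x.
Proof. by move=> sb bx c cb; apply: bx => i /sb /cb. Qed.

Lemma word_max_split w : w != [::] ->
  exists v m v', [/\ w = v ++ m :: v', all (fun i => i <= m)%N v
                   & all (fun i => i < m)%N v'].
Proof.
elim: w => //= x [|y w] IHw _; first by exists [::], x, [::].
have [//|v [m [v' [-> vm v'm]]]] := IHw.
have [xm|mx] := leqP x m.
  by exists (x :: v), m, v'; split=> //=; rewrite xm.
exists [::], x, (v ++ m :: v'); split=> //=.
rewrite all_cat /= mx; apply/and3P; split=> //.
  by apply: sub_all vm => i im; apply: leq_ltn_trans mx.
by apply: sub_all v'm => i im; apply: ltn_trans mx.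
Qed.

Hypothesis relE : chinese_relations.

Lemma rel_right i k j : (i <= k <= j)%N -> a j * a i * a k = a j * a k * a i.
Proof. by case/relE. Qed.

Lemma rel_left i k j : (i <= k <= j)%N -> a j * a k * a i = a k * a j * a i.
Proof. by case/relE. Qed.

(** Chaining the two Chinese relations moves [a k] across the pair. In particular the product of the
    largest and the smallest letter commutes with every letter. *)
Lemma pair_comm i k j : (i <= k <= j)%N -> GRing.comm (a j * a i) (a k).
Proof.
by move=> ikj; rewrite /GRing.comm rel_right // rel_left // mulrA.
Qed.

Lemma pair_comm_word lo hi w :
  within lo hi w -> GRing.comm (a hi * a lo) (eval_word w).
Proof. by move/allP=> wlh; apply: comm_eval_word => i /wlh;
  apply: pair_comm. Qed.

(** Write [w = v m v'] at the last largest letter [m]. By induction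
    [a m * v' * a lo = a m * a lo * u]; the pair [a m * a lo] passes over [v], and
    [a hi * a m * a lo = a hi * a lo * a m], so [w' = m v u] works. That [w'] does not depend on
    [lo] and [hi] is essential later, where one word is extracted between different pairs. *)
Lemma pair_extract w : exists w', {subset w' <= w} /\
  forall lo hi, within lo hi w ->
    a hi * eval_word w * a lo = a hi * a lo * eval_word w'.
Proof.
have [k] := ubnP (size w); elim: k w => // k IHk w /ltnSE wk.
have [->|w0] := eqVneq w [::].
  by exists [::]; split=> // lo hi _; rewrite eval_nil !mulr1.
have [v [m [v' [wE vm v'm]]]] := word_max_split w0.
have [|u [uv' uE]] := IHk v'.
  by apply: leq_trans wk; rewrite wE size_cat /= addnS ltnS leq_addl.
exists (m :: v ++ u); split=> [i|lo hi].
  rewrite wE !(in_cons, mem_cat) => /orP[->|/orP[->|/uv'->]] //=;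
  by rewrite ?orbT.
rewrite wE {1}/within all_cat /= => /and3P[vlh /andP[lom mhi] v'lh].
have v'lm : within lo m v'.
  by apply/allP=> i iv';
    rewrite (ltnW (allP v'm _ iv')) (andP (allP v'lh _ iv')).1.
have vlm : within lo m v.
  by apply/allP=> i iv; rewrite (allP vm _ iv) (andP (allP vlh _ iv)).1.
have E1 := uE _ _ v'lm; have E2 := pair_comm_word vlm.
have E3 : a hi * a m * a lo = a hi * a lo * a m by rewrite -rel_right ?lom ?mhi.
rewrite eval_cat !eval_cons eval_cat.
transitivity (a hi * eval_word v * (a m * eval_word v' * a lo)).
  by rewrite !mulrA.
rewrite E1 -[a hi * _ * _]mulrA [eval_word v * _]mulrA -E2.
by rewrite !mulrA E3.
Qed.

(** Every [hi] standing before a [lo] is extracted with it as a central pair; what remains has all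
    its [lo] before all its [hi]. *)
Lemma pair_normal lo hi w : (lo < hi)%N -> within lo hi w ->
  exists k u v, [/\ eval_word w = (a hi * a lo) ^+ k * eval_word (u ++ v),
    {subset u ++ v <= w}, hi \notin u & lo \notin v].
Proof.
move=> lh; elim: w => [|x w IHw] /=.
  by exists 0%N, [::], [::]; split; rewrite // expr0 mul1r.
case/andP=> xlh wlh; have [k [u [v [wE sw hiu lov]]]] := IHw wlh.
have sxw t : {subset t <= w} -> {subset x :: t <= x :: w}.
  by move=> tw i; rewrite !in_cons => /orP[->|/tw ->] //; rewrite orbT.
have zx : GRing.comm (a x) ((a hi * a lo) ^+ k).
  by apply/commrX/commr_sym/pair_comm.
have {}wE : eval_word (x :: w) = (a hi * a lo) ^+ k * eval_word (x :: u ++ v).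
  by rewrite !eval_cons wE mulrA zx -mulrA.
have [xhi|xhi] := eqVneq x hi; last first.
  exists k, (x :: u), v; split=> //; first exact: sxw.
  by rewrite in_cons negb_or eq_sym xhi.
have [lou|lou] := boolP (lo \in u); last first.
  exists k, [::], (x :: u ++ v); split=> //; first exact: sxw.
  by rewrite in_cons mem_cat !negb_or xhi ltn_eqF //= lou lov.
(* The new leading [hi] has a [lo] behind it in [u]: this pair leaves as one more factor
   [a hi * a lo]. *)
case/splitPr: lou wE sw hiu => u1 u2 wE sw hiu.
have uw i : i \in u1 -> i \in w by move=> iu; apply: sw; rewrite !mem_cat iu.
have [u1' [su1 u1E]] := pair_extract u1.
exists k.+1, (u1' ++ u2), v; split.
- have u1lh : within lo hi u1 by apply/allP=> i /uw /(allP wlh).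
  rewrite wE xhi exprSr -!mulrA; congr (_ * _).
  rewrite eval_cons -!catA !eval_cat eval_cons !mulrA.
  by rewrite (u1E _ _ u1lh).
- move=> i; rewrite in_cons !mem_cat => iu; apply/orP; right.
  case/orP: iu => [/orP[/su1 /uw //|iu2]|iv]; apply: sw.
    by rewrite !(mem_cat, in_cons) iu2 !orbT.
  by rewrite !(mem_cat, in_cons) iv !orbT.
- move: hiu; rewrite !(mem_cat, in_cons) !negb_or => /and3P[h1 _ ->].
  by rewrite andbT; apply: contra h1 => /su1.
- exact: lov.
Qed.

End Words.

(** * Elimination of letters in a prime corner *)

Section Corners.

Variables (R : pzRingType) (a : nat -> R).

Local Notation ev := (eval_word a).

(* [corner_prime] says that the subring generated by the letters of [b] becomes
   prime modulo the annihilator of [H]; the bicommutant of the letters is a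
   convenient substitute for that subring. *)
Record prime_corner (b : seq nat) (H : R) : Prop := PrimeCorner {
  corner_neq0 : H <> 0;
  corner_comm : {in b, forall i, GRing.comm H (a i)};
  corner_prime : forall x y, bicommutant a b x -> bicommutant a b y ->
    (forall w, {subset w <= b} -> x * ev w * y * H = 0) ->
    x * H = 0 \/ y * H = 0 }.

(** Commutativity of the product [uxu * uyu = uxuyu] modulo the annihilator of [H], tested on words
    only; bilinearity extends it later. *)
Definition commuting_corner (b : seq nat) (H u : R) : Prop :=
  forall w w', {subset w <= b} -> {subset w' <= b} ->
    u * ev w * u * ev w' * u * H = u * ev w' * u * ev w * u * H.

Lemma corner_bicommutant b H x :
  prime_corner b H -> bicommutant a b x -> GRing.comm H x.
Proof. by move=> [_ Hb _]; apply. Qed.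

(** A central [z] passes over the test word, so [z * w * x * H = w * (z * x * H) = 0], and primeness
    applies with [z * H] nonzero. *)
Lemma corner_torsionfree b H z x :
  prime_corner b H -> {in b, forall i, GRing.comm z (a i)} ->
  bicommutant a b z -> z * H <> 0 -> bicommutant a b x ->
  z * x * H = 0 -> x * H = 0.
Proof.
move=> [_ _ Pr] zb bz zH bx zxH; have [] // := Pr z x bz bx.
move=> w wb; have zw : GRing.comm z (ev w) by apply: bicommutant_word zb.
by rewrite zw -!mulrA [z * _]mulrA zxH mulr0.
Qed.

(** * Deleting a letter that is proportional to a word in the others *)

Section Deletion.

Variables (b : seq nat) (H : R) (l : nat) (z g : R) (w0 : seq nat).
Let b' := [seq i <- b | i != l].

Hypothesis pcH : prime_corner b H.
Hypothesis zb : {in b, forall i, GRing.comm z (a i)}.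
Hypothesis bz : bicommutant a b z.
Hypothesis zH : z * H <> 0.
Hypothesis bg : bicommutant a b g.
Hypothesis gHb : {in b, forall i, GRing.comm (g * H) (a i)}.
Hypothesis w0b : {subset w0 <= b'}.
Hypothesis lE : z * a l * H = g * ev w0 * H.

Let b'b : {subset b' <= b}.
Proof. by move=> i; rewrite mem_filter => /andP[]. Qed.

Let bc x : bicommutant a b x -> H * x = x * H.
Proof. exact: corner_bicommutant. Qed.

Let gkHb k : {in b, forall i, GRing.comm (g ^+ k * H) (a i)}.
Proof.
elim: k => [|k IHk] i ib.
  by rewrite expr0 mul1r; apply: (corner_comm pcH).
have bgk : bicommutant a b (g ^+ k).
  by move=> c cb; apply/commrX/bg.
rewrite /GRing.comm exprS -!mulrA [H * _](corner_comm pcH ib).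
rewrite [g ^+ k * _]mulrA -[g ^+ k * _ * H]mulrA -[a i * H](corner_comm pcH ib).
rewrite [g ^+ k * _]mulrA IHk // -[in LHS]bc // !mulrA -[g * a i * H]mulrA.
rewrite -(corner_comm pcH ib) mulrA gHb // -!mulrA bc //.
Qed.

Let gkH k x : bicommutant a b x -> g ^+ k * H * x = x * (g ^+ k * H).
Proof. by apply; apply: gkHb. Qed.

Let bgk k : bicommutant a b (g ^+ k).
Proof. by move=> c cb; apply/commrX/bg. Qed.

Let zkb k : {in b, forall i, GRing.comm (z ^+ k) (a i)}.
Proof. by move=> i ib; apply/commr_sym/commrX/commr_sym/zb. Qed.

Let zk k x : bicommutant a b x -> z ^+ k * x = x * z ^+ k.
Proof. by apply; apply: zkb. Qed.

Let bw w : {subset w <= b} -> bicommutant a b (ev w).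
Proof. exact: bicommutant_word. Qed.

Let bzk k : bicommutant a b (z ^+ k).
Proof. by move=> c cb; apply/commrX/bz. Qed.

Let zkreg k x : bicommutant a b x -> z ^+ k * x * H = 0 -> x * H = 0.
Proof.
move=> bx; elim: k => [|k IHk]; first by rewrite mul1r.
rewrite exprS -[z * _ * x]mulrA => /(corner_torsionfree pcH zb bz zH) zkx.
by apply/IHk/zkx/bicommutantM.
Qed.

Let zpush k x y : bicommutant a b x -> z ^+ k * (x * y) = x * (z ^+ k * y).
Proof. by move=> bx; rewrite mulrA zk // mulrA. Qed.

(** Only [g * H], not [g] itself, is known to commute with the letters. Powers of [g] can therefore
    be moved only in front of an element that ends in [H]. *)
Let HM (v : R) := exists2 y, bicommutant a b y & v = y * H.

Let HM1 : HM H.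
Proof. by exists 1; [apply: bicommutant1|rewrite mul1r]. Qed.

Let HMM x v : bicommutant a b x -> HM v -> HM (x * v).
Proof.
by move=> bx [y by_ ->]; exists (x * y); [apply: bicommutantM|rewrite mulrA].
Qed.

Let gpush k x v : bicommutant a b x -> HM v ->
  g ^+ k * (x * v) = x * (g ^+ k * v).
Proof.
move=> bx [y by_ ->].
by rewrite -!bc // [x * _]mulrA -bc // !mulrA gkH // !mulrA.
Qed.

Let zg_exchange n x x' v : z ^+ n * (x * H) = g ^+ n * (x' * H) -> HM v ->
  z ^+ n * (x * v) = g ^+ n * (x' * v).
Proof.
move=> xE [y by_ ->]; rewrite -bc // [x * _]mulrA mulrA xE.
by rewrite -!mulrA.
Qed.

(** Each occurrence of [l] absorbs one [z] and is replaced by [w0] at the price of one [g], whence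
    the same exponent on both sides. *)
Lemma deletion_word w : {subset w <= b} -> exists k w', {subset w' <= b'} /\
  z ^+ k * (ev w * H) = g ^+ k * (ev w' * H).
Proof.
elim: w => [|i w IHw] wb; first by exists 0%N, [::]; rewrite !mul1r.
have ib : i \in b by apply: wb; rewrite mem_head.
have bi := bicommutant_letter ib (a := a).
have {}wb : {subset w <= b} by move=> j jw; apply: wb; rewrite in_cons jw orbT.
have [k [w' [w'b wE]]] := IHw wb.
have bw' : bicommutant a b (ev w') by apply/bw => j /w'b /b'b.
have [il|il] := eqVneq i l; last first.
  exists k, (i :: w'); split.
    move=> j; rewrite in_cons => /orP[/eqP->|/w'b //].
    by rewrite mem_filter il.
  by rewrite !eval_cons -!mulrA zpush // wE (gpush k bi) //;
    do ?[exact: HM1|apply: HMM => //].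
exists k.+1, (w0 ++ w'); split.
  by move=> j; rewrite mem_cat => /orP[/w0b|/w'b].
rewrite eval_cons eval_cat !exprS -!mulrA zpush // wE -gpush //;
  do ?[exact: HM1|apply: HMM => //].
rewrite -[z]expr1 zpush // expr1 -bc // [a i * _]mulrA [z * _]mulrA.
rewrite [z * _]mulrA il lE -!mulrA bc // mulrA -[g ^+ k * g]exprSr exprS.
by rewrite -mulrA.
Qed.

(** A power of [z] turns a test word in [b] into one in [b'], and [z] can be cancelled by
    [corner_torsionfree]. *)
Lemma deletion_corner : prime_corner b' H.
Proof.
split; first exact: corner_neq0 pcH.
  by move=> i /b'b; apply: (corner_comm pcH).
move=> x y /(bicommutantS b'b) bx /(bicommutantS b'b) by_ xyH.
apply: (corner_prime pcH) => // w wb.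
have [k [w' [w'b wE]]] := deletion_word wb.
have bw' : bicommutant a b (ev w') by apply/bw => j /w'b /b'b.
have bww := bw wb.
apply: (@zkreg k); first by do 2!apply: bicommutantM => //.
rewrite -!mulrA zpush // (zg_exchange wE) -?(gpush k bx);
  do ?[exact: HM1|apply: HMM => //].
by have:= xyH _ w'b; rewrite -!mulrA => ->; rewrite mulr0.
Qed.

Lemma deletion_commuting u : bicommutant a b' u ->
  commuting_corner b' H u -> commuting_corner b H u.
Proof.
move=> /(bicommutantS b'b) bu uE.
(* One exponent and one pair of reduced words must serve both orders of [w] and [v], so that the
   commutation over [b'] can be inserted and the power of [z] cancelled. *)
suff key w v : {subset w <= b} -> {subset v <= b} ->
  exists k k' w' v', [/\ {subset w' <= b'}, {subset v' <= b'},
  z ^+ (k + k') * (u * ev w * u * ev v * u * H) =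
    g ^+ (k + k') * (u * ev w' * u * ev v' * u * H) &
  z ^+ (k + k') * (u * ev v * u * ev w * u * H) =
    g ^+ (k + k') * (u * ev v' * u * ev w' * u * H)].
  move=> w v wb vb; have [k [k' [w' [v' [w'b v'b E1 E2]]]]] := key w v wb vb.
  have bww := bw wb; have bv := bw vb.
  apply/eqP; rewrite -subr_eq0 -mulrBl; apply/eqP.
  apply: (@zkreg (k + k')).
    by apply: bicommutantB; do !apply: bicommutantM => //.
  by rewrite -mulrA mulrBl mulrBr E1 E2 uE // subrr.
move=> wb vb; have [k [w' [w'b wE]]] := deletion_word wb.
have [k' [v' [v'b vE]]] := deletion_word vb.
have [bww bv] := (bw wb, bw vb).
have bw' : bicommutant a b (ev w') by apply/bw => j /w'b /b'b.
have bv' : bicommutant a b (ev v') by apply/bw => j /v'b /b'b.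
have gen n m x y x' y' : bicommutant a b x -> bicommutant a b y ->
    bicommutant a b x' -> bicommutant a b y' ->
    z ^+ n * (x * H) = g ^+ n * (x' * H) ->
    z ^+ m * (y * H) = g ^+ m * (y' * H) ->
    z ^+ (n + m) * (u * x * u * y * u * H) =
    g ^+ (n + m) * (u * x' * u * y' * u * H).
  move=> bx by_ bx' by' xE yE; rewrite [in RHS]addnC !exprD -!mulrA.
  have HMy : HM (y' * (u * H)) by do ?[exact: HM1|apply: HMM => //].
  rewrite (zpush m) // (zpush m) // (zpush m) // (zg_exchange yE) //;
    last by do ?[exact: HM1|apply: HMM => //].
  rewrite -(gpush m bu) // -(gpush m bx) //; last exact: HMM.
  rewrite -(gpush m bu) //; last by do 2!apply: HMM => //.
  rewrite (zpush n _ (bgk m)) (zpush n) // (zg_exchange xE) //; last exact: HMM.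
  by rewrite -(gpush n bu) //; do 2!apply: HMM => //.
exists k, k', w', v'; split=> //; first exact: gen.
by rewrite addnC; apply: gen.
Qed.

End Deletion.
End Corners.

Lemma first_split (T : eqType) (x : T) w : x \in w ->
  exists u v, w = u ++ x :: v /\ x \notin u.
Proof.
elim: w => // y w IHw; rewrite in_cons.
have [->|xy] /= := eqVneq x y; first by exists [::], w.
by case/IHw => u [v [-> xu]]; exists (y :: u), v; rewrite in_cons negb_or xy.
Qed.

Lemma last_split (T : eqType) (x : T) w : x \in w ->
  exists u v, w = u ++ x :: v /\ x \notin v.
Proof.
rewrite -mem_rev => /first_split[u [v [wE xu]]].
exists (rev v), (rev u); rewrite mem_rev; split=> //.
by rewrite -[w]revK wE rev_cat rev_cons cat_rcons.
Qed.

(** * Peeling off the two outer letters *)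

Section Peeling.

Variables (R : pzRingType) (a : nat -> R).

Local Notation ev := (eval_word a).

Hypothesis relE : chinese_relations a.

Variables (b b' : seq nat) (H F : R) (lo hi : nat).

Hypothesis pcH : prime_corner a b H.
Hypothesis lohi : (lo < hi)%N.
Hypothesis lob : lo \in b.
Hypothesis hib : hi \in b.
Hypothesis blh : within lo hi b.
Hypothesis b'b : {subset b' <= b}.
Hypothesis bb' : forall i, i \in b -> i != lo -> i != hi -> i \in b'.
Hypothesis bF : bicommutant a b F.
Hypothesis Fb' : {in b', forall i, GRing.comm F (a i)}.
Hypothesis Flo : F * (a lo * H) = 0.
Hypothesis hiF : a hi * (F * H) = 0.
Hypothesis FH0 : F * H <> 0.

Let z := a hi * a lo.

Let bc x : bicommutant a b x -> H * x = x * H.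
Proof. exact: corner_bicommutant. Qed.

Let Fc x : bicommutant a b' x -> F * x = x * F.
Proof. by apply. Qed.

Let wlh w : {subset w <= b} -> within lo hi w.
Proof. by move=> wb; apply/allP => i /wb /(allP blh). Qed.

Let bw w : {subset w <= b} -> bicommutant a b (ev w).
Proof. exact: bicommutant_word. Qed.

Let bw' w : {subset w <= b'} -> bicommutant a b' (ev w).
Proof. exact: bicommutant_word. Qed.

Let zb : {in b, forall i, GRing.comm z (a i)}.
Proof. by move=> i ib; apply: (pair_comm relE); apply: (allP blh). Qed.

Let Flo_x x : bicommutant a b x -> F * (a lo * (x * H)) = 0.
Proof. by move=> bx; rewrite -bc // [a lo * _]mulrA mulrA Flo mul0r. Qed.

Let hiF_x x : bicommutant a b' x -> a hi * (x * (F * H)) = 0.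
Proof.
move=> bx; rewrite [x * _]mulrA -Fc // -mulrA -bc; last exact: bicommutantS bx.
by rewrite [F * _]mulrA mulrA hiF mul0r.
Qed.

(** The coefficients that can occur in [F w F H = c F F H]: zero, or a power of the central [z]
    times a word in the inner letters. *)
Definition peeled (c : R) : Prop :=
  c = 0 \/ exists k w, {subset w <= b'} /\ c = z ^+ k * ev w.

(** In the normal form [z^k u v] the left [F] annihilates any [lo] in [u], the right [F] any [hi] in
    [v]; if neither occurs, the word is inner and commutes with [F]. *)
Lemma peel_word w : {subset w <= b} -> exists2 c, peeled c &
  F * (ev w * (F * H)) = c * (F * (F * H)).
Proof.
move=> wb; have [k [u [v [wE uvw hiu lov]]]] :=
  pair_normal relE lohi (wlh wb).
have uvb i : i \in u ++ v -> i \in b by move/uvw/wb.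
have zF : z ^+ k * F = F * z ^+ k.
  by apply: bF => i ib; apply/commr_sym/commrX/commr_sym/zb.
have {}wE x : F * (ev w * x) = z ^+ k * (F * (ev (u ++ v) * x)).
  by rewrite wE !mulrA zF.
rewrite wE.
(* Only inner letters precede the first [lo] of [u], so [F] can be moved up to it. *)
have [/first_split[u1 [u2 [uE lou1]]]|lou] := boolP (lo \in u).
  exists 0; first by left.
  have u1b : {subset u1 <= b'}.
    move=> i iu1; have iu : i \in u by rewrite uE mem_cat iu1.
    apply: bb'; first by apply: uvb; rewrite mem_cat iu.
      by apply: contraNneq lou1 => <-.
    by apply: contraNneq hiu => <-.
  have bu2 : bicommutant a b (ev u2 * ev v * F).
    apply/bicommutantM/bF; rewrite -eval_cat; apply: bw => i iuv; apply: uvb.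
    by move: iuv; rewrite uE !mem_cat in_cons => /orP[->|->]; rewrite !orbT.
  rewrite eval_cat uE eval_cat eval_cons -!mulrA.
  rewrite [F * (ev u1 * _)]mulrA (Fc (bw' u1b)) [ev u2 * _]mulrA.
  by rewrite [ev u2 * _ * _]mulrA -mulrA Flo_x // mul0r !mulr0.
(* Symmetrically, only inner letters follow the last [hi] of [v]. *)
have [/last_split[v1 [v2 [vE hiv2]]]|hiv] := boolP (hi \in v).
  exists 0; first by left.
  have v2b : {subset v2 <= b'}.
    move=> i iv2; have iv : i \in v by rewrite vE mem_cat in_cons iv2 !orbT.
    apply: bb'; first by apply: uvb; rewrite mem_cat iv orbT.
      by apply: contraNneq lov => <-.
    by apply: contraNneq hiv2 => <-.
  rewrite eval_cat vE eval_cat eval_cons -!mulrA hiF_x; last exact: bw'.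
  by rewrite mul0r !mulr0.
have uvb' : {subset u ++ v <= b'}.
  move=> i iuv; apply: bb'; first exact: uvb.
    by apply: contraTneq iuv => ->; rewrite mem_cat negb_or lou.
  by apply: contraTneq iuv => ->; rewrite mem_cat negb_or hiu.
exists (z ^+ k * ev (u ++ v)); first by right; exists k, (u ++ v).
by rewrite [F * _]mulrA (Fc (bw' uvb')) !mulrA.
Qed.

Let peel_word_tail w : {subset w <= b} -> exists2 c, peeled c &
  forall t, bicommutant a b t ->
    F * (ev w * (F * (t * H))) = c * (F * (F * (t * H))).
Proof.
case/peel_word => c cP cE; exists c => // t bt.
have FtH x : x * (F * (t * H)) = x * (F * H) * t by rewrite -bc // !mulrA.
by rewrite !FtH !mulrA -[_ * F * H]mulrA -[F * _ * _]mulrA cE !mulrA.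
Qed.

Let zk k x : bicommutant a b x -> x * z ^+ k = z ^+ k * x.
Proof.
by move=> bx; apply: esym; apply: bx => i ib;
  apply/commr_sym/commrX/commr_sym/zb.
Qed.

Let Fpush x t : F * x = x * F -> F * (x * t) = x * (F * t).
Proof. by move=> xF; rewrite mulrA xF -mulrA. Qed.

(** Primeness over [b] is applied to [x * F] and [y * F]: a word between them collapses to zero or
    to a central power times an inner word, where the assumption on [x] and [y] applies. *)
Lemma peel_corner : prime_corner a b' (F * H).
Proof.
split=> // [i ib'|x y bx' by' xyH].
  apply/commr_sym/commrM; first exact/commr_sym/Fb'.
  exact/commr_sym/(corner_comm pcH)/b'b.
have bx := bicommutantS b'b bx'; have by_ := bicommutantS b'b by'.
have [||w wb|xFH|yFH] := corner_prime pcH (x := x * F) (y := y * F).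
- exact: bicommutantM.
- exact: bicommutantM.
- have [c cP cE] := peel_word_tail wb.
  have -> : x * F * ev w * (y * F) * H = x * (F * (ev w * (F * (y * H)))).
    by rewrite -(Fc by') !mulrA.
  rewrite cE // !(Fpush _ (Fc by')) -(bc bF).
  case: cP => [->|[k [w' [w'b' ->]]]]; first by rewrite mul0r mulr0.
  rewrite -mulrA mulrA zk // -mulrA; have := xyH _ w'b';
    rewrite -!mulrA => xyH'.
  rewrite [F * (H * F)]mulrA [y * _]mulrA [ev w' * _]mulrA [x * _]mulrA.
  by rewrite xyH' mul0r mulr0.
- left; by rewrite mulrA.
right; by rewrite mulrA.
Qed.

(** With coefficients [c] and [d] of the two words, both sides become [u c u d u F^3 H] up to
    exchanging [c] and [d]. These are zero or central powers times inner words, which commute in the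
    corner of [u]. *)
Lemma peel_commuting u : bicommutant a b' u ->
  commuting_corner a b' (F * H) u -> commuting_corner a b H (u * F).
Proof.
move=> bu' uE w v wb vb.
have bu := bicommutantS b'b bu'.
have Fu := Fc bu'.
have pc c : peeled c -> F * c = c * F /\ bicommutant a b c.
  case=> [->|[k [x [xb' ->]]]].
    by rewrite mulr0 mul0r; split=> // d _; apply: commr0.
  split; last first.
    apply: bicommutantM; last by apply: bw => i /xb' /b'b.
    by move=> d dlo; apply/commrX/commrM; apply: dlo.
  by rewrite mulrA zk // -mulrA Fc ?mulrA //; apply: bw'.
have [[c cP cE] [d dP dE]] := (peel_word_tail wb, peel_word_tail vb).
have [[cF bcc] [dF bd]] := (pc c cP, pc d dP).
have gen x y c1 d1 : F * c1 = c1 * F -> bicommutant a b c1 ->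
    F * d1 = d1 * F -> bicommutant a b d1 ->
    (forall t, bicommutant a b t ->
      F * (ev x * (F * (t * H))) = c1 * (F * (F * (t * H)))) ->
    (forall t, bicommutant a b t ->
      F * (ev y * (F * (t * H))) = d1 * (F * (F * (t * H)))) ->
    u * F * ev x * (u * F) * ev y * (u * F) * H =
      u * c1 * u * d1 * u * (F * (F * (F * H))).
  move=> Fc1 bc1 Fd1 bd1 xE yE; rewrite -!mulrA -(Fpush H Fu) yE //.
  have bT : bicommutant a b (u * d1 * F * u) by do !apply: bicommutantM => //.
  have -> : u * (d1 * (F * (F * (u * H)))) = F * (u * d1 * F * u * H).
    by rewrite -!mulrA !(Fpush _ Fu, Fpush _ Fd1).
  by rewrite xE // -!mulrA !(Fpush _ Fu, Fpush _ Fd1).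
rewrite (gen _ _ c d) // (gen _ _ d c) //.
suff cd : u * c * u * d * u * (F * H) = u * d * u * c * u * (F * H).
  have E : F * (F * (F * H)) = F * H * (F * F).
    by rewrite -[RHS]mulrA bc ?mulrA //; apply: bicommutantM.
  by rewrite E !mulrA -[_ * F * H]mulrA cd // !mulrA.
case: cP cF bcc cE => [->|[k [w' [w'b' ->]]]] _ _ _.
  by rewrite !(mulr0, mul0r).
case: dP dF bd dE => [->|[m [v' [v'b' ->]]]] _ _ _.
  by rewrite !(mulr0, mul0r).
have zout n p x y : bicommutant a b x -> bicommutant a b y ->
  u * (z ^+ n * x) * u * (z ^+ p * y) * u * (F * H) =
  z ^+ (n + p) * (u * x * u * y * u * (F * H)).
  move=> bx by_; have zpush q r s : bicommutant a b r ->
      r * (z ^+ q * s) = z ^+ q * (r * s) by move=> br;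
        rewrite mulrA zk // -mulrA.
  by rewrite exprD -!mulrA !(zpush _ u) // (zpush p x) // !(zpush p u).
have bww : bicommutant a b (ev w') by apply: bw => i /w'b' /b'b.
have bvv : bicommutant a b (ev v') by apply: bw => i /v'b' /b'b.
by rewrite !zout // addnC uE.
Qed.

End Peeling.

(** * Commutators of the extreme letters *)

Section OuterPair.

Variables (R : pzRingType) (a : nat -> R).

Local Notation ev := (eval_word a).

Hypothesis relE : chinese_relations a.

Lemma outer_commutator_low lo hi : (lo <= hi)%N ->
  (a hi * a lo - a lo * a hi) * a lo = 0.
Proof.
move=> lohi; rewrite mulrBl -[a lo * _ * _]mulrA.
by rewrite (pair_comm relE (k := lo)) ?leqnn // mulrA subrr.
Qed.

Lemma outer_commutator_high lo hi : (lo <= hi)%N ->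
  a hi * (a hi * a lo - a lo * a hi) = 0.
Proof.
move=> lohi; rewrite mulrBr [a hi * (a lo * _)]mulrA.
by rewrite (pair_comm relE (k := hi)) ?leqnn ?andbT // subrr.
Qed.

(* The first, second, last but one and last letters; [l2 = l3] is allowed. *)
Variables (lo l2 l3 hi : nat).
Hypotheses (lo_l2 : (lo < l2)%N) (l2_l3 : (l2 <= l3)%N) (l3_hi : (l3 < hi)%N).

Let z := a hi * a lo.
Let e := z - a lo * a hi.
Let E := a l2 * a lo - a lo * a l2.
Let D := a hi * a l3 - a l3 * a hi.
Let F := a l3 * e * a l2.

Let lohi : (lo < hi)%N.
Proof. exact: leq_ltn_trans (leq_trans (ltnW lo_l2) l2_l3) l3_hi. Qed.

Let lo_l3 : (lo < l3)%N. Proof. exact: leq_trans lo_l2 l2_l3. Qed.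
Let l2_hi : (l2 < hi)%N. Proof. exact: leq_ltn_trans l2_l3 l3_hi. Qed.

Let pc i k j : (i <= k <= j)%N -> GRing.comm (a j * a i) (a k).
Proof. exact: pair_comm. Qed.

Let pcw i j w : within i j w -> GRing.comm (a j * a i) (ev w).
Proof. exact: pair_comm_word. Qed.

Let zl k : (lo <= k <= hi)%N -> z * a k = a k * z.
Proof. exact: pc. Qed.

(** Both terms of [e] yield [z * a l3 * a lo * v'], with the same [v'] because [pair_extract] is
    uniform in the outer letters. *)
Let l3e_lo v : within lo l3 v -> a l3 * e * ev v * a lo = 0.
Proof.
move=> vw; have vw' : within lo hi v.
  by apply/allP => i /(allP vw)/andP[-> il3] /=;
    apply: leq_trans il3 (ltnW l3_hi).
have [v' [_ vE]] := pair_extract relE v.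
rewrite mulrBr -zl ?(ltnW lo_l3) ?(ltnW l3_hi) // !mulrBl -!mulrA.
rewrite [a l3 * (ev v * _)]mulrA vE // [a hi * (ev v * _)]mulrA vE //.
rewrite -/z [a lo * (z * _)]mulrA -zl ?leqnn ?(ltnW lohi) //.
rewrite [a l3 * (_ * _)]mulrA [a l3 * (_ * _)]mulrA -zl ?(ltnW lo_l3)
  ?(ltnW l3_hi) //.
by rewrite -!mulrA subrr.
Qed.

(** The mirror image: both terms of [e] yield [z * a hi * a l2 * v']. *)
Let hi_el2 v : within l2 hi v -> a hi * ev v * e * a l2 = 0.
Proof.
move=> vw; have vw' : within lo hi v.
  by apply/allP => i /(allP vw)/andP[l2i ->];
    rewrite andbT (leq_trans (ltnW lo_l2)).
have [v' [v'v vE]] := pair_extract relE v.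
have v'w : within l2 hi v' by apply/allP => i /v'v/(allP vw).
have zv : z * ev v = ev v * z by apply: pcw.
rewrite mulrBr mulrBl -mulrA.
have -> : a hi * ev v * (z * a l2) = z * (a hi * ev v * a l2).
  rewrite -[LHS]mulrA [ev v * _]mulrA -zv -mulrA mulrA -zl ?leqnn ?(ltnW lohi)
    //.
  by rewrite !mulrA.
rewrite vE // [a hi * ev v * _]mulrA vE // -/z -!mulrA [a hi * (a l2 * _)]mulrA.
by rewrite pcw // subrr.
Qed.

Let lE k : (l2 <= k)%N -> a k * E = 0.
Proof.
move=> l2k; have := @rel_right _ _ relE lo l2 k;
  rewrite (ltnW lo_l2) => /(_ l2k).
by rewrite mulrBr !mulrA => ->; rewrite subrr.
Qed.

Let Dl k : (k <= l3)%N -> D * a k = 0.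
Proof.
move=> kl3; have := @rel_left _ _ relE k l3 hi;
  rewrite kl3 (ltnW l3_hi) => /(_ isT).
by rewrite mulrBl => ->; rewrite subrr.
Qed.

Variables (b : seq nat) (H : R).
Hypotheses (lob : lo \in b) (l2b : l2 \in b) (l3b : l3 \in b) (hib : hi \in b).
Hypothesis bE : forall i, i \in b -> [|| i == lo, i == hi | (l2 <= i <= l3)%N].

Let blh : within lo hi b.
Proof.
apply/allP => i /bE/or3P[/eqP->|/eqP->|/andP[l2i il3]].
- by rewrite leqnn ltnW.
- by rewrite leqnn ltnW.
by rewrite (leq_trans (ltnW lo_l2)) // (leq_trans il3) // ltnW.
Qed.

Let wlh w : {subset w <= b} -> within lo hi w.
Proof. by move=> wb; apply/allP => i /wb /(allP blh). Qed.

Let bl := @bicommutant_letter _ a b.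

Let be : bicommutant a b e.
Proof. by apply: bicommutantB; apply: bicommutantM; apply: bl. Qed.

Let zk k x : bicommutant a b x -> x * z ^+ k = z ^+ k * x.
Proof.
move=> bx; apply: esym; apply: bx => i ib.
by apply/commr_sym/commrX/commr_sym/pc; apply: (allP blh).
Qed.

Let zout k x y t : bicommutant a b x ->
  x * (z ^+ k * y) * t = z ^+ k * (x * (y * t)).
Proof. by move=> bx; rewrite mulrA zk // !mulrA. Qed.

Let normal w : {subset w <= b} -> exists k u v,
  [/\ ev w = z ^+ k * ev (u ++ v), {subset u ++ v <= b},
    hi \notin u & lo \notin v].
Proof.
move=> wb; have [k [u [v [wE uvw hiu lov]]]] := pair_normal relE lohi (wlh wb).
by exists k, u, v; split=> // i /uvw /wb.
Qed.

Let no_hi w : {subset w <= b} -> hi \notin w -> within lo l3 w.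
Proof.
move=> wb hiw; apply/allP => i iw;
  case/or3P: (bE (wb _ iw)) => [/eqP->|/eqP ih|/andP[l2i ->]].
- by rewrite leqnn ltnW.
- by rewrite -ih iw in hiw.
by rewrite andbT (leq_trans (ltnW lo_l2)).
Qed.

Let no_lo w : {subset w <= b} -> lo \notin w -> within l2 hi w.
Proof.
move=> wb low; apply/allP => i iw;
  case/or3P: (bE (wb _ iw)) => [/eqP il|/eqP->|/andP[-> il3]].
- by rewrite -il iw in low.
- by rewrite leqnn ltnW.
by rewrite (leq_trans il3) // ltnW.
Qed.

Let kill_lo u x : {subset u <= b} -> hi \notin u -> lo \in u ->
  a l3 * e * (ev u * x) = 0.
Proof.
move=> ub hiu /first_split[u1 [u2 [uE lou1]]].
have su1 : {subset u1 <= u} by move=> i iu; rewrite uE mem_cat iu.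
rewrite uE eval_cat eval_cons !mulrA l3e_lo ?mul0r //.
by apply: no_hi => [i /su1 /ub //|]; apply: contra hiu => /su1.
Qed.

Let kill_hi v x : {subset v <= b} -> lo \notin v -> hi \in v ->
  x * ev v * (e * a l2) = 0.
Proof.
move=> vb lov /last_split[v1 [v2 [vE hiv2]]].
have sv2 : {subset v2 <= v} by move=> i iv; rewrite vE mem_cat in_cons iv !orbT.
rewrite vE eval_cat eval_cons -!mulrA [a hi * _]mulrA [_ * (e * _)]mulrA hi_el2
  ?mulr0 //.
by apply: no_lo => [i /sv2 /vb //|]; apply: contra lov => /sv2.
Qed.

Let bf : bicommutant a b (e * a l2). Proof. exact/bicommutantM/bl. Qed.
Let bf' : bicommutant a b (a l3 * e). Proof. exact/bicommutantM/be/bl. Qed.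

Let zl3 : z * a l3 = a l3 * z.
Proof. by apply: zl; rewrite (ltnW lo_l3) (ltnW l3_hi). Qed.

Let l3eE : a l3 * e * E = 0.
Proof.
rewrite -mulrA [e * E]mulrBl -[a lo * a hi * E]mulrA lE ?(ltnW l2_hi) // mulr0.
by rewrite subr0 mulrA -zl3 -mulrA lE ?mulr0.
Qed.

Let Del2 : D * (e * a l2) = 0.
Proof.
rewrite mulrA [D * e]mulrBr [D * (a lo * _)]mulrA Dl ?(ltnW lo_l3) //.
rewrite mul0r subr0 -mulrA zl ?mulrA ?Dl ?mul0r //.
by rewrite (ltnW lo_l2) (ltnW l2_hi).
Qed.

(** In normal form a [lo] in [u] is killed by [a l3 * e]. Without it the last letter is at least
    [l2], hence annihilates [E] from the left. *)
Lemma low_commutator_orthogonal w : {subset w <= b} -> a l3 * e * ev w * E = 0.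
Proof.
case/normal => k [u [v [-> uvb hiu lov]]].
have sub_r : {subset v <= b} by move=> i iv; apply: uvb;
  rewrite mem_cat iv orbT.
have sub_l : {subset u <= b} by move=> i iu; apply: uvb; rewrite mem_cat iu.
rewrite zout //; have [lou|lou] := boolP (lo \in u).
  by rewrite eval_cat -[ev u * _ * _]mulrA kill_lo ?mulr0.
have louv : lo \notin u ++ v by rewrite mem_cat negb_or lou.
case/lastP: (u ++ v) louv uvb => [|t j] lot tb.
  by rewrite eval_nil mul1r l3eE mulr0.
rewrite eval_rcons -!mulrA lE ?mulr0 //.
have jt : j \in rcons t j by rewrite mem_rcons mem_head.
by case/andP: (allP (no_lo tb lot) _ jt).
Qed.

(** Dually, a [hi] in [v] is killed by [e * a l2]; without it the first letter is at most [l3] and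
    is annihilated by [D]. *)
Lemma high_commutator_orthogonal w : {subset w <= b} ->
  D * ev w * (e * a l2) = 0.
Proof.
case/normal => k [u [v [-> uvb hiu lov]]].
have sub_r : {subset v <= b} by move=> i iv; apply: uvb;
  rewrite mem_cat iv orbT.
have bD : bicommutant a b D by apply: bicommutantB; apply: bicommutantM;
  apply: bl.
rewrite zout //; have [hiv|hiv] := boolP (hi \in v).
  by rewrite eval_cat [D * _]mulrA [D * _]mulrA kill_hi ?mulr0.
have hiuv : hi \notin u ++ v by rewrite mem_cat negb_or hiu.
case: (u ++ v) hiuv uvb => [|j t] hit tb.
  by rewrite eval_nil mul1r Del2 mulr0.
rewrite eval_cons !mulrA -[z ^+ k * D * _]mulrA Dl ?(mulr0, mul0r) //.
by case/andP: (allP (no_hi tb hit) _ (mem_head _ _)).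
Qed.

(** [F] is a combination of products of pairs, each of which encloses [i] and so commutes with
    [a i]. *)
Lemma outer_corner_comm i : (l2 <= i <= l3)%N -> GRing.comm (a i) F.
Proof.
move=> /andP[l2i il3].
have -> : F = z * (a l3 * a l2) - a l3 * a lo * (a hi * a l2).
  by rewrite /F mulrBr mulrBl -zl3 !mulrA.
apply: commrB; apply: commrM; apply: commr_sym; apply: pc.
- by rewrite (leq_trans (ltnW lo_l2)) // (leq_trans il3) // ltnW.
- by rewrite l2i.
- by rewrite il3 (leq_trans (ltnW lo_l2)).
- by rewrite l2i (leq_trans il3) // ltnW.
Qed.

(** If [F * H] were zero, this would make [a l3 * e] and [e * a l2] orthogonal on [H], against
    primeness. *)
Lemma outer_sandwich w : {subset w <= b} ->
  exists c, a l3 * e * ev w * (e * a l2) = c * F.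
Proof.
case/normal => k [u [v [-> uvb hiu lov]]].
have sub_r : {subset v <= b} by move=> i iv; apply: uvb;
  rewrite mem_cat iv orbT.
have sub_l : {subset u <= b} by move=> i iu; apply: uvb; rewrite mem_cat iu.
rewrite zout //; have [lou|lou] := boolP (lo \in u).
  by exists 0; rewrite eval_cat -[ev u * _ * _]mulrA kill_lo ?(mulr0, mul0r).
have [hiv|hiv] := boolP (hi \in v).
  by exists 0; rewrite eval_cat [a l3 * e * _]mulrA [a l3 * e * (_ * _)]mulrA
    kill_hi ?(mulr0, mul0r).
have hiuv : hi \notin u ++ v by rewrite mem_cat negb_or hiu.
have louv : lo \notin u ++ v by rewrite mem_cat negb_or lou.
have l2uv := no_lo uvb louv; have lol3 := no_hi uvb hiuv.
move: (u ++ v) uvb l2uv lol3 => t tb l2t l3t {u v hiu lov sub_l sub_r lou hiv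
  hiuv louv}.
have l23t : within l2 l3 t.
  by apply/allP => i it;
    rewrite (andP (allP l2t _ it)).1 (andP (allP l3t _ it)).2.
have [t' [t't tE]] := pair_extract relE t.
exists (z ^+ k * z * ev t').
have Ft : GRing.comm F (ev t').
  by apply: comm_eval_word => i /t't /(allP l23t) /outer_corner_comm /commr_sym.
suff E1 : a l3 * e * (ev t * (e * a l2)) = z * (F * ev t')
  by rewrite E1 Ft !mulrA.
have lot : within lo l3 t.
  by apply/allP => i /(allP l23t)/andP[l2i ->];
    rewrite (leq_trans (ltnW lo_l2)).
have lht : within lo hi t.
  by apply/allP => i /(allP lot)/andP[-> il3]; rewrite (leq_trans il3) // ltnW.
have l2ht : within l2 hi t' by apply/allP => i /t't /(allP l2t).
have zt : z * ev t = ev t * z by apply: pcw.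
have step1 : a l3 * e * (ev t * (e * a l2)) = z * (a l3 * ev t * (e * a l2)).
  rewrite mulrBr mulrBl -zl3 -!mulrA.
  have := hi_el2 l2t; rewrite -!mulrA => ->.
  by rewrite !mulr0 subr0.
rewrite step1; congr (_ * _).
have -> : a l3 * ev t * (e * a l2) =
    z * (a l3 * ev t * a l2) - a l3 * ev t * a lo * (a hi * a l2).
  rewrite mulrBl mulrBr -[a lo * a hi * _]mulrA.
  rewrite [a l3 * ev t * (a lo * _)]mulrA; congr (_ - _).
  by rewrite mulrA -[a l3 * _ * z]mulrA -zt mulrA -zl3 !mulrA.
rewrite !tE // -[a l3 * a lo * _ * _]mulrA -pcw // /F.
by rewrite mulrBr !mulrBl -zl3 !mulrA.
Qed.

(** Primeness turns the orthogonality relations into [E * H = 0] and [D * H = 0]. So [a lo] can be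
    moved past [a l2] towards [e], and [a hi] past [a l3], where [e * a lo = 0] and
    [a hi * e = 0]. *)
Lemma outer_corner : prime_corner a b H ->
  e * a l2 * H <> 0 -> a l3 * e * H <> 0 ->
  [/\ F * H <> 0, F * (a lo * H) = 0 & a hi * (F * H) = 0].
Proof.
move=> pcH fH f'H; split.
- move=> FH; have [w wb|//|//] := corner_prime pcH bf' bf.
  by have [c ->] := outer_sandwich wb; rewrite -mulrA FH mulr0.
- have bE' : bicommutant a b E by apply: bicommutantB; apply: bicommutantM;
  apply: bl.
  have [w wb|//|EH] := corner_prime pcH bf' bE'.
    by rewrite low_commutator_orthogonal // mul0r.
  have El2 : a l2 * (a lo * H) = a lo * (a l2 * H).
    by apply/eqP; rewrite -subr_eq0 !mulrA -mulrBl; apply/eqP.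
  by rewrite /F -!mulrA El2 [e * _]mulrA (outer_commutator_low (ltnW lohi))
    mul0r mulr0.
have bD : bicommutant a b D by apply: bicommutantB; apply: bicommutantM;
  apply: bl.
have [w wb|DH|//] := corner_prime pcH bD bf.
  by rewrite high_commutator_orthogonal // mul0r.
have D0 : a hi * a l3 * H = a l3 * a hi * H.
  by apply/eqP; rewrite -subr_eq0 -mulrBl; apply/eqP.
rewrite /F -!mulrA [e * _]mulrA -(corner_bicommutant pcH bf) mulrA mulrA D0.
rewrite -mulrA (corner_bicommutant pcH bf) -!mulrA [a hi * _]mulrA.
by rewrite (outer_commutator_high (ltnW lohi)) mul0r mulr0.
Qed.

End OuterPair.

Lemma sorted_within b : sorted ltn b -> b != [::] ->
  exists lo hi, [/\ lo \in b, hi \in b & within lo hi b].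
Proof.
rewrite sorted_pairwise; last exact: ltn_trans.
move=> bs b0; exists (head 0%N b), (last 0%N b); split.
- by case: b b0 {bs} => //= i b _; rewrite mem_head.
- by case: b b0 {bs} => //= i b _; rewrite mem_last.
apply/allP => i ib; apply/andP; split.
  case: b bs ib {b0} => //= j b /andP[/allP jb _]; rewrite in_cons.
  by case/orP=> [/eqP->|/jb /ltnW].
case/lastP: b bs ib {b0} => //= b j; rewrite pairwise_rcons last_rcons.
case/andP=> /allP bj _; rewrite mem_rcons in_cons.
by case/orP=> [/eqP->|/bj /ltnW].
Qed.

(** * Existence of a commuting corner, by induction on the letters *)

Section CommutingCorner.

Variables (R : pzRingType) (a : nat -> R).

Local Notation ev := (eval_word a).

Hypothesis relE : chinese_relations a.

(** An abstract degree predicate, to be instantiated by the images of homogeneous elements in the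
    quotient. *)
Variable homog : nat -> R -> Prop.
Hypothesis homog1 : homog 0 1.
Hypothesis homog_letter : forall i, homog 1 (a i).
Hypothesis homogB : forall d x y, homog d x -> homog d y -> homog d (x - y).
Hypothesis homogM : forall d d' x y,
  homog d x -> homog d' y -> homog (d + d') (x * y).

Definition has_commuting_corner (b : seq nat) (H : R) : Prop := exists u d,
  [/\ homog d u, bicommutant a b u, u * H <> 0 & commuting_corner a b H u].

Lemma commuting_corner_deletion b H l z g w0 : prime_corner a b H ->
  {in b, forall i, GRing.comm z (a i)} -> bicommutant a b z -> z * H <> 0 ->
  bicommutant a b g -> {in b, forall i, GRing.comm (g * H) (a i)} ->
  {subset w0 <= [seq i <- b | i != l]} -> z * a l * H = g * ev w0 * H ->
  (prime_corner a [seq i <- b | i != l] H ->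
    has_commuting_corner [seq i <- b | i != l] H) ->
  has_commuting_corner b H.
Proof.
move=> pcH zb bz zH bg gHb w0b lE.
case; first exact: (deletion_corner pcH zb bz zH bg gHb w0b lE).
move=> u [d [du bu uH cu]].
exists u, d; split=> //.
  by apply: bicommutantS bu => i; rewrite mem_filter => /andP[].
exact: (deletion_commuting pcH zb bz zH bg gHb w0b lE).
Qed.

(** Deletion with [z = 1] and the empty word: the letter acts on [H] as a central element. *)
Lemma commuting_corner_central b H l g : prime_corner a b H ->
  bicommutant a b g -> {in b, forall i, GRing.comm (g * H) (a i)} ->
  a l * H = g * H -> (prime_corner a [seq i <- b | i != l] H ->
    has_commuting_corner [seq i <- b | i != l] H) ->
  has_commuting_corner b H.
Proof.
move=> pcH bg gHb lE;
  apply: (commuting_corner_deletion (z := 1) (g := g) (w0 := [::])) => //.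
- by move=> i _; apply/commr_sym/commr1.
- exact: bicommutant1.
- by rewrite mul1r; apply: (corner_neq0 pcH).
by rewrite mul1r eval_nil mulr1.
Qed.

Lemma commuting_corner_zero b H l : prime_corner a b H -> a l * H = 0 ->
  (prime_corner a [seq i <- b | i != l] H ->
    has_commuting_corner [seq i <- b | i != l] H) ->
  has_commuting_corner b H.
Proof.
move=> pcH lH; apply: (commuting_corner_central (g := 0)) => //;
  last by rewrite lH mul0r.
  by move=> c _; apply: commr0.
by move=> i _; rewrite mul0r; apply/commr_sym/commr0.
Qed.

Lemma commuting_corner_peeling b b' H F lo hi d : prime_corner a b H ->
  (lo < hi)%N ->
  lo \in b -> hi \in b -> within lo hi b -> {subset b' <= b} ->
  (forall i, i \in b -> i != lo -> i != hi -> i \in b') ->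
  homog d F -> bicommutant a b F -> {in b', forall i, GRing.comm F (a i)} ->
  F * (a lo * H) = 0 -> a hi * (F * H) = 0 -> F * H <> 0 ->
  (prime_corner a b' (F * H) -> has_commuting_corner b' (F * H)) ->
    has_commuting_corner b H.
Proof.
move=> pcH lohi lob hib blh b'b bb' dF bF Fb' Flo hiF FH.
case; first exact: (peel_corner relE pcH lohi).
move=> u [d' [du bu uFH cu]]; exists (u * F), (d' + d)%N; split.
- exact: homogM.
- by apply: bicommutantM => //; apply: bicommutantS bu.
- by rewrite -mulrA.
by apply: (peel_commuting relE pcH lohi (b' := b')) => //; exact: FH.
Qed.

Theorem exists_commuting_corner b H :
  sorted ltn b -> prime_corner a b H -> has_commuting_corner b H.
Proof.
have [n] := ubnP (size b); elim: n b H => // n IHn b H /ltnSE sb bs pcH.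
have IHdel l : l \in b ->
    prime_corner a [seq i <- b | i != l] H ->
      has_commuting_corner [seq i <- b | i != l] H.
  move=> lb; apply: IHn; last exact: (sorted_filter ltn_trans).
  apply: leq_trans sb; rewrite size_filter -(count_predC (pred1 l) b).
  by rewrite -[ltnLHS]add0n ltn_add2r -has_count has_pred1.
case: b => [|lo b] in sb bs pcH IHdel *.
  exists 1, 0%N; split=> //; first exact: bicommutant1.
    by rewrite mul1r; apply: (corner_neq0 pcH).
  move=> w v w0 v0; have nil (t : seq nat) : {subset t <= [::]} -> t = [::].
    by case: t => // i t /(_ i); rewrite mem_head => /(_ isT).
  by rewrite (nil w) // (nil v).
have lob : lo \in lo :: b by rewrite mem_head.
case/lastP: b => [|b hi] in sb bs pcH IHdel lob *.
  apply: (commuting_corner_central (l := lo) (g := a lo)) (IHdel _ lob) => //.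
    exact: bicommutant_letter.
  move=> i; rewrite inE => /eqP->; apply/commr_sym/commrM;
    first exact: commr_refl.
  exact/commr_sym/(corner_comm pcH).
have hib : hi \in lo :: rcons b hi by rewrite in_cons mem_rcons mem_head orbT.
have lor i : i \in lo :: rcons b hi = [|| i == lo, i == hi | i \in b].
  by rewrite in_cons mem_rcons in_cons.
move: (bs); rewrite sorted_pairwise; last exact: ltn_trans.
rewrite pairwise_cons pairwise_rcons all_rcons -sorted_pairwise;
  last exact: ltn_trans.
case/andP=> /andP[lohi lo_b] /andP[b_hi sb'].
have blh : within lo hi (lo :: rcons b hi).
  apply/allP => i; rewrite lor => /or3P[/eqP->|/eqP->|ib].
  - by rewrite leqnn ltnW.
  - by rewrite leqnn ltnW.
  by rewrite (ltnW (allP lo_b _ ib)) (ltnW (allP b_hi _ ib)).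
set bb := lo :: rcons b hi in sb bs pcH IHdel lob hib lor blh *.
have pc i : i \in bb -> GRing.comm (a hi * a lo) (a i).
  by move=> ib; apply: (pair_comm relE); apply: (allP blh).
have bl i : i \in bb -> bicommutant a bb (a i) by apply: bicommutant_letter.
have Hi i : i \in bb -> H * a i = a i * H := @corner_comm _ _ _ _ pcH i.
(* Any word between [a hi] and [a lo] can be extracted, so [z * H = 0] makes one of the two letters
   kill [H] by primeness. *)
have [zH|zH] := eqVneq (a hi * a lo * H) 0.
  have [w wb|hiH|loH] := corner_prime pcH (bl _ hib) (bl _ lob).
  - have [w' [w'w ->]] := pair_extract relE w; last first.
      by apply/allP => i /wb /(allP blh).
    have bw' : bicommutant a bb (ev w')
      by apply: bicommutant_word => i /w'w /wb.
    by rewrite -mulrA -(corner_bicommutant pcH bw') mulrA zH mul0r.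
  - exact: commuting_corner_zero hiH (IHdel _ hib).
  exact: commuting_corner_zero loH (IHdel _ lob).
move/eqP in zH.
set e := a hi * a lo - a lo * a hi.
have be : bicommutant a bb e.
  by apply: bicommutantB; apply: bicommutantM; apply: bl.
have eE x y : x * e * y = 0 -> x * (a hi * a lo) * y = x * (a lo * a hi) * y.
  by move/eqP; rewrite mulrBr mulrBl subr_eq0 => /eqP.
have bsub : {subset b <= bb} by move=> i ib; rewrite lor ib !orbT.
have bb'E i : i \in bb -> i != lo -> i != hi -> i \in b.
  by rewrite lor => /or3P[/eqP->|/eqP->|//]; rewrite eqxx.
have de : homog 2 e.
  by apply: homogB; apply: (homogM (d := 1) (d' := 1)); apply: homog_letter.
(* With two letters only, either they commute on [H], or [e] itself serves as the peeling
   element. *)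
case: (posnP (size b)) => [/eqP/nilP b0|b_gt0].
  have [eH|eH] := eqVneq (e * H) 0.
    apply: (commuting_corner_central (l := hi) (g := a hi))
      (IHdel _ hib) => //; first exact: bl.
    move=> i; rewrite lor b0 orbF /GRing.comm => /orP[/eqP->|/eqP->];
      last first.
      by rewrite -mulrA Hi // mulrA.
    by have := eE 1 H; rewrite !mul1r => /(_ eH); rewrite -!mulrA Hi.
  apply: (commuting_corner_peeling (b' := b) (F := e) (d := 2) pcH lohi) => //.
  - by move=> i; rewrite b0.
  - by rewrite mulrA (outer_commutator_low relE (ltnW lohi)) mul0r.
  - by rewrite mulrA (outer_commutator_high relE (ltnW lohi)) mul0r.
  - exact/eqP.
  move=> pce; apply: IHn => //.
  by apply: leq_trans sb; rewrite /bb /= size_rcons ltnS leqnSn.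
have [|l2 [l3 [l2b l3b b23]]] := sorted_within sb'.
  by case: (b) b_gt0.
have lo_l2 : (lo < l2)%N by apply: (allP lo_b).
have l3_hi : (l3 < hi)%N by apply: (allP b_hi).
have l2_l3 : (l2 <= l3)%N by case/andP: (allP b23 _ l2b).
have [l2bb l3bb] := (bsub _ l2b, bsub _ l3b).
have between i : i \in bb -> [|| i == lo, i == hi | l2 <= i <= l3]%N.
  by rewrite lor => /or3P[->|->|/(allP b23) ->]; rewrite ?orbT.
have zbb : bicommutant a bb (a hi * a lo) by apply: bicommutantM; apply: bl.
have ge_l2 i : i \in bb -> i != lo -> (l2 <= i <= hi)%N.
  move=> /between/or3P[/eqP->|/eqP->|/andP[-> il3] _]; first by rewrite eqxx.
    by rewrite leqnn (leq_trans l2_l3) // ltnW.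
  by rewrite (leq_trans il3) // ltnW.
have le_l3 i : i \in bb -> i != hi -> (lo <= i <= l3)%N.
  move=> /between/or3P[/eqP->|/eqP->|/andP[l2i ->] _]; last 1 first.
  - by rewrite (leq_trans (ltnW lo_l2)).
  - by rewrite leqnn (leq_trans (ltnW lo_l2)).
  by rewrite eqxx.
(* Here [z * a l2] equals [(a hi * a l2) * a lo] on [H]. The factor [a hi * a l2] commutes with the
   letters from [l2] on as a pair, and with [a lo] by the vanishing just assumed. *)
have [fH|fH] := eqVneq (e * a l2 * H) 0.
  have l2E : a hi * a lo * a l2 * H = a hi * a l2 * a lo * H.
    by rewrite (rel_right relE) // (ltnW lo_l2) (leq_trans l2_l3) // ltnW.
  have := eE 1 (a l2 * H); rewrite !mul1r !mulrA => /(_ fH) eqf.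
  apply: (commuting_corner_deletion (l := l2) (z := a hi * a lo)
    (g := a hi * a l2)
    (w0 := [:: lo]) pcH _ _ _ _ _ _ _ (IHdel _ l2bb)) => //.
  - by apply: bicommutantM; apply: bl.
  - move=> i ib; rewrite /GRing.comm -mulrA Hi // mulrA.
    have [->|ilo] := eqVneq i lo; first by rewrite -l2E eqf !mulrA.
    by rewrite (pair_comm relE) ?mulrA //; apply: ge_l2.
  - by move=> i; rewrite inE => /eqP->; rewrite mem_filter lob ltn_eqF.
  by rewrite eval_cons eval_nil mulr1 l2E.
(* The mirror case: [z * a l3] equals [(a l3 * a lo) * a hi] on [H]. *)
have [f'H|f'H] := eqVneq (a l3 * e * H) 0.
  have zl3 : a hi * a lo * a l3 = a l3 * (a hi * a lo) by apply: pc.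
  have := eE (a l3) H f'H; rewrite !mulrA => eqf.
  have l3E : a hi * a l3 * a lo * H = a l3 * a hi * a lo * H.
    by rewrite (rel_left relE) // (ltnW l3_hi) (leq_trans (ltnW lo_l2)).
  apply: (commuting_corner_deletion (l := l3) (z := a hi * a lo)
    (g := a l3 * a lo)
    (w0 := [:: hi]) pcH _ _ _ _ _ _ _ (IHdel _ l3bb)) => //.
  - by apply: bicommutantM; apply: bl.
  - move=> i ib; rewrite /GRing.comm -mulrA Hi // mulrA.
    have [->|ihi] := eqVneq i hi; first by rewrite -eqf -l3E !mulrA.
    by rewrite (pair_comm relE) ?mulrA //; apply: le_l3.
  - by move=> i; rewrite inE => /eqP->; rewrite mem_filter hib gtn_eqF.
  by rewrite eval_cons eval_nil mulr1 zl3 mulrA eqf.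
have [||FH Flo hiF] := outer_corner relE lo_l2 l2_l3 l3_hi lob l2bb l3bb hib
  between pcH;
  try exact/eqP.
apply: (commuting_corner_peeling (b' := b) (F := a l3 * e * a l2) (d := 4)
  pcH lohi) => //.
- apply: (homogM (d := 3) (d' := 1)) => //; exact: (homogM (d := 1) (d' := 2)).
- by apply: bicommutantM; [apply: bicommutantM => //|]; apply: bl.
- move=> i /(allP b23) ib.
  by apply/commr_sym/(outer_corner_comm relE lo_l2 l2_l3 l3_hi).
move=> pcF; apply: IHn => //; apply: leq_trans sb.
by rewrite /bb /= size_rcons ltnS leqnSn.
Qed.

End CommutingCorner.

(** * Jacobson radical, prime ideals and gradings *)

Section Jacobson.

Variable R : pzRingType.

(** Zorn's lemma on the proper left ideals containing [L]; a nonempty chain is bounded by its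
    union. *)
Lemma maximal_left_ideal_above (L : {pred R}) : left_ideal L -> 1 \notin L ->
  exists2 I, maximal_left_ideal I & {subset L <= I}.
Proof.
move=> lL L1; pose T := {I : {pred R} | [/\ left_ideal I,
  1 \notin I & {subset L <= I}]}.
have t0 : T by exists L; split.
pose leT (I J : T) := `[< {subset sval I <= sval J} >].
have leTxx I : leT I I by apply/asboolP.
have leT_trans I J K : leT I J -> leT J K -> leT I K.
  by move=> /asboolP IJ /asboolP JK; apply/asboolP => x /IJ /JK.
have [C Ctot|[I [lI I1 LI]] Imax] := ZL_preorder t0 leTxx leT_trans.
  (* The empty chain is bounded by [L] itself. *)
  have [[t1 Ct1]|C0] := pselect (exists t, C t); last first.
    by exists t0 => s Cs; case: C0; exists s.
  pose U : {pred R} := fun x => `[< exists2 t : T, C t & x \in sval t >].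
  have UP x : reflect (exists2 t : T, C t & x \in sval t) (x \in U)
    by apply: asboolP.
  have Uideal : left_ideal U.
    split; first split.
    - by apply/UP; exists t1 => //; case: (svalP t1) => -[[]].
    - move=> x y /UP[s Cs xs] /UP[t Ct yt]; apply/UP.
      case: (Ctot s t Cs Ct) => /asboolP st.
        by exists t => //; case: (svalP t) => -[[_ tB] _] _ _; apply/tB/yt/st.
      by exists s => //; case: (svalP s) => -[[_ sB] _] _ _; apply/sB/st.
    move=> a x /UP[t Ct xt]; apply/UP; exists t => //.
    by case: (svalP t) => -[_ tM] _ _; apply: tM.
  have U1 : 1 \notin U.
    by apply/UP => -[t _]; apply/negP; case: (svalP t).
  have LU : {subset L <= U}.
    by move=> x xL; apply/UP; exists t1 => //; case: (svalP t1) => _ _; apply.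
  exists (exist _ U (And3 Uideal U1 LU)) => s Cs.
  by apply/asboolP => x xs; apply/UP; exists s.
exists I => //; split=> // J lJ J1 IJ.
have LJ : {subset L <= J} by move=> x /LI /IJ.
by apply/asboolP/(Imax (exist _ J (And3 lJ J1 LJ)))/asboolP.
Qed.

(** The radical is an intersection of left ideals, so the right factor [s] is first moved to the
    left: a left inverse [c] of [1 - ba] gives the left inverse [1 + acb] of [1 - ab]. *)
Lemma jacobson_radical_left_inverse (x y s : R) : in_jacobson_radical x ->
  exists c, c * (1 - y * x * s) = 1.
Proof.
move=> Jx.
suff [c cE] : exists c, c * (1 - s * y * x) = 1.
  exists (1 + y * x * c * s).
  rewrite mulrDl mul1r mulrBr mulr1.
  have -> : y * x * c * s * (y * x * s) = y * x * (c * (s * y * x)) * s.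
    by rewrite !mulrA.
  have -> : c * (s * y * x) = c - 1 by rewrite -cE mulrBr mulr1 opprB addrC
    subrK.
  by rewrite mulrBr mulrBl mulr1 subKr subrK.
pose L : {pred R} := fun r => `[< exists c, c * (1 - s * y * x) = r >].
have LP r : reflect (exists c, c * (1 - s * y * x) = r) (r \in L)
  by apply: asboolP.
have [/LP//|L1] := boolP (1 \in L).
have lL : left_ideal L.
  split; first split.
  - by apply/LP; exists 0; rewrite mul0r.
  - by move=> _ _ /LP[c <-] /LP[d <-]; apply/LP; exists (c - d); rewrite mulrBl.
  by move=> a _ /LP[c <-]; apply/LP; exists (a * c); rewrite mulrA.
have [I Imax LI] := maximal_left_ideal_above lL L1.
have xI := Jx I Imax; case: Imax => -[[_ IB] IM] I1 _.
case/negP: I1; have -> : 1 = 1 - s * y * x - (0 - s * y * x).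
  by rewrite sub0r opprK subrK.
have I0 : 0 \in I by rewrite -(subrr x) IB.
by apply: (IB); [apply/LI/LP; exists 1; rewrite mul1r|apply: (IB) => //;
  apply: IM].
Qed.

End Jacobson.

(** * Prime ideals in terms of elements *)

Section Primes.

Variable A : pzRingType.

Definition ideal_of (I : A -> bool) (zI : zmod_closed I)
    (lI : forall a, {in I, forall x, a * x \in I})
    (rI : forall a, {in I, forall x, x * a \in I}) : twosidedIdeal A :=
  HB.pack I (GRing.isZmodClosed.Build A I zI) (isTwoSided.Build A I lI rI).

Lemma idealMl (P : twosidedIdeal A) a x : x \in P -> a * x \in P.
Proof. exact: idealMl_subproof. Qed.

Lemma idealMr (P : twosidedIdeal A) a x : x \in P -> x * a \in P.
Proof. exact: idealMr_subproof. Qed.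

Definition elementwise_prime (P : {pred A}) : Prop :=
  forall x y, (forall r, x * r * y \in P) -> x \in P \/ y \in P.

(** Instead of the ideals generated by [x] and [y], annihilators modulo [P] are used: [J] consists
    of the [y'] with [x A y' A] inside [P], and [I] of the [x'] with [x' A J] inside [P]. *)
Lemma prime_ideal_elementwise (P : twosidedIdeal A) :
  prime_ideal P -> elementwise_prime P.
Proof.
case=> _ Pprime x y xPy.
pose J (y' : A) := `[< forall r s, x * r * y' * s \in P >].
have JP y' : reflect (forall r s, x * r * y' * s \in P) (J y')
  by apply: asboolP.
have zJ : zmod_closed J.
  split; first by apply/JP => r s; rewrite mulr0 mul0r rpred0.
  by move=> u v /JP uP /JP vP; apply/JP => r s; rewrite mulrBr mulrBl rpredB.
have lJ a : {in J, forall u, a * u \in J}.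
  by move=> u /JP uP; apply/JP => r s; rewrite !mulrA -[x * r * a]mulrA.
have rJ a : {in J, forall u, u * a \in J}.
  by move=> u /JP uP; apply/JP => r s; rewrite mulrA -mulrA.
pose I (x' : A) := `[< forall r u, J u -> x' * r * u \in P >].
have IP x' : reflect (forall r u, J u -> x' * r * u \in P) (I x')
  by apply: asboolP.
have zI : zmod_closed I.
  split; first by apply/IP => r u _; rewrite !mul0r rpred0.
  move=> u v /IP uP /IP vP; apply/IP => r t Jt.
  by rewrite !mulrBl rpredB ?uP ?vP.
have lI a : {in I, forall u, a * u \in I}.
  by move=> u /IP uP; apply/IP => r t Jt; rewrite -!mulrA idealMl // mulrA uP.
have rI a : {in I, forall u, u * a \in I}.
  by move=> u /IP uP; apply/IP => r t Jt; rewrite -[u * a * r]mulrA uP.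
have [u v uI vJ|IsP|JsP] := Pprime (ideal_of zI lI rI) (ideal_of zJ lJ rJ).
- by have /IP/(_ 1 v vJ) := uI; rewrite mulr1.
- left; apply: IsP; apply/IP => r u /JP/(_ r 1); rewrite mulr1; apply.
right; apply: JsP; apply/JP => r s; rewrite idealMr //; exact: xPy.
Qed.

Lemma elementwise_prime_ideal (P : twosidedIdeal A) :
  1 \notin P -> elementwise_prime P -> prime_ideal P.
Proof.
move=> P1 Pel; split=> // I J IJ.
have [IP|/existsNP[x /not_implyP[xI xP]]] := pselect {subset I <= P};
  first by left.
have [JP|/existsNP[y /not_implyP[yJ yP]]] := pselect {subset J <= P};
  first by right.
by case: (Pel x y) => // r; rewrite -mulrA; apply: IJ => //; apply: idealMl.
Qed.

End Primes.

Lemma polyXn_mulCA (A : nzRingType) k (p q : {poly A}) :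
  'X^k * (p * q) = p * ('X^k * q).
Proof. by rewrite mulrA -commr_polyXn -mulrA. Qed.

Lemma mul_monomials (A : nzRingType) (x y : A) d d' :
  x%:P * 'X^d * (y%:P * 'X^d') = (x * y)%:P * 'X^(d + d').
Proof. by rewrite -mulrA polyXn_mulCA polyCM exprD !mulrA. Qed.

(** * Gradings and homogeneous primes *)

Section Graded.

(** The grading is encoded by the ring morphism sending [x] to the sum of its components [x_d 'X^d];
    evaluation at 1 adds the components up again. *)
Variables (A : nzRingType) (phi : {rmorphism A -> {poly A}}).

Hypothesis phi1 : forall x, (phi x).[1] = x.

Definition homogeneous (d : nat) (x : A) : Prop := phi x = x%:P * 'X^d.

Hypothesis phi_homog : forall x d, homogeneous d (phi x)`_d.

Lemma homogeneous1 : homogeneous 0 1.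
Proof. by rewrite /homogeneous rmorph1 mulr1. Qed.

Lemma homogeneousB d x y :
  homogeneous d x -> homogeneous d y -> homogeneous d (x - y).
Proof. by rewrite /homogeneous => xd yd;
  rewrite rmorphB /= xd yd polyCB mulrBl. Qed.

Lemma homogeneousM d d' x y :
  homogeneous d x -> homogeneous d' y -> homogeneous (d + d') (x * y).
Proof.
by rewrite /homogeneous => xd yd; rewrite rmorphM /= xd yd mul_monomials.
Qed.

Lemma sum_components x : x = \sum_(i < size (phi x)) (phi x)`_i.
Proof.
by rewrite -{1}[x]phi1 horner_coef; apply: eq_bigr => i _; rewrite expr1n mulr1.
Qed.

Lemma ideal_components (P : twosidedIdeal A) x :
  (forall d, (phi x)`_d \in P) -> x \in P.
Proof. by move=> xP; rewrite [x]sum_components rpred_sum. Qed.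

Lemma homogeneous_sandwich d d' x y z :
  homogeneous d x -> homogeneous d' z ->
  phi (x * y * z) = x%:P * phi y * z%:P * 'X^(d + d').
Proof.
rewrite /homogeneous => xd zd'; rewrite !rmorphM /= xd zd' exprD.
by rewrite -!mulrA !polyXn_mulCA.
Qed.

Lemma coef_homogeneous_sandwich d d' x y z k :
  homogeneous d x -> homogeneous d' z ->
  (phi (x * y * z))`_(k + (d + d')) = x * (phi y)`_k * z.
Proof.
move=> xd zd'; rewrite (homogeneous_sandwich _ xd zd').
by rewrite coefMXn ltnNge leq_addl /= addnK coefMC coefCM.
Qed.

Lemma coef_homogeneous d x k : homogeneous d x -> (phi x)`_k = x *+ (k == d).
Proof.
by rewrite /homogeneous => ->; rewrite coefCM coefXn; case: eqP;
  rewrite ?mulr1 ?mulr0.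
Qed.

Lemma coef_homogeneous_middle x r y k m : homogeneous k r ->
  (phi (x * r * y))`_(m + k) =
  \sum_(i < m.+1) (phi x)`_i * r * (phi y)`_(m - i).
Proof.
rewrite /homogeneous => rk; rewrite !rmorphM /= rk.
have -> : phi x * (r%:P * 'X^k) * phi y = phi x * r%:P * phi y * 'X^k.
  by rewrite -!mulrA commr_polyXn.
rewrite coefMXn ltnNge leq_addl /= addnK coefM.
by apply: eq_bigr => i _; rewrite coefMC.
Qed.

Definition homogeneous_ideal (P : {pred A}) : Prop :=
  forall x d, x \in P -> (phi x)`_d \in P.

Section HomogeneousPart.

Variable P : twosidedIdeal A.

Definition homogeneous_part (x : A) : bool := `[< forall d, (phi x)`_d \in P >].

Let hP x : reflect (forall d, (phi x)`_d \in P) (x \in homogeneous_part).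
Proof. exact: asboolP. Qed.

Let zmod_part : zmod_closed homogeneous_part.
Proof.
split; first by apply/hP => d; rewrite rmorph0 coef0 rpred0.
by move=> x y /hP xP /hP yP; apply/hP => d; rewrite rmorphB coefB rpredB.
Qed.

Let part_Ml a : {in homogeneous_part, forall x, a * x \in homogeneous_part}.
Proof.
move=> x /hP xP; apply/hP => d; rewrite rmorphM coefM rpred_sum // => i _.
exact: idealMl.
Qed.

Let part_Mr a : {in homogeneous_part, forall x, x * a \in homogeneous_part}.
Proof.
move=> x /hP xP; apply/hP => d; rewrite rmorphM coefM rpred_sum // => i _.
exact: idealMr.
Qed.

Definition homogeneous_part_ideal := ideal_of zmod_part part_Ml part_Mr.

(** Take the lowest components [x_d] and [y_d'] outside [P]. For [r] homogeneous of degree [k], the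
    component of [x r y] in degree [d + d' + k] is [x_d r y_d'] up to terms in [P], so primeness of
    [P] is contradicted. *)
Lemma homogeneous_part_prime : prime_ideal P ->
  prime_ideal homogeneous_part_ideal.
Proof.
move=> Pprime; have Pel := prime_ideal_elementwise Pprime.
have {Pprime} [P1 _] := Pprime.
apply: elementwise_prime_ideal.
  by apply/hP => /(_ 0%N); rewrite rmorph1 coef1 /=; apply/negP.
move=> x y xyP; apply/orP; apply: contraT;
  rewrite negb_or => /andP[/hP xP /hP yP].
have ex t : ~ (forall d, (phi t)`_d \in P) -> exists d, (phi t)`_d \notin P.
  by move=> /existsNP[d dP]; exists d; apply/negP.
have [d dP dmin] := ex_minnP (ex _ xP).
have [d' d'P d'min] := ex_minnP (ex _ yP).
have lowx i : (i < d)%N -> (phi x)`_i \in P.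
  by apply: contraTT => /dmin; rewrite -leqNgt.
have lowy i : (i < d')%N -> (phi y)`_i \in P.
  by apply: contraTT => /d'min; rewrite -leqNgt.
suff key : forall r, (phi x)`_d * r * (phi y)`_d' \in P.
  by case: (Pel _ _ key) => h; [rewrite h in dP|rewrite h in d'P].
move=> r; rewrite [r]sum_components mulr_sumr mulr_suml rpred_sum // => k _.
set r' := _`_k; have r'k : homogeneous k r' by apply: phi_homog.
have /hP/(_ (d + d' + k)%N) := xyP r'; rewrite coef_homogeneous_middle //.
have dlt : (d < (d + d').+1)%N by rewrite ltnS leq_addr.
rewrite (bigD1 (Ordinal dlt)) //= addKn => xryP.
rewrite -[X in X \in P](addrK (\sum_(i < (d + d').+1 | i != Ordinal dlt)
  (phi x)`_i * r' * (phi y)`_(d + d' - i))) rpredB // rpred_sum // => i ne.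
have [/lowx xiP|di] := ltnP i d; first by rewrite -mulrA idealMr.
apply/idealMl/lowy; have idd' : (i <= d + d')%N := leq_ord i.
rewrite -(ltn_add2r i) subnK // [ltnRHS]addnC ltn_add2r.
by rewrite ltn_neqAle di andbT eq_sym; apply: contra ne => /eqP ?;
  apply/eqP/val_inj.
Qed.

Lemma minimal_prime_homogeneous : minimal_prime_ideal P -> homogeneous_ideal P.
Proof.
case=> Pprime Pmin x d xP.
have sub : {subset homogeneous_part_ideal <= P}.
  by move=> y /hP; apply: ideal_components.
by have /hP := Pmin _ (homogeneous_part_prime Pprime) sub x xP.
Qed.

End HomogeneousPart.

(** * The commutative graded corner and quasi-regularity *)

Section CommutingCorner.

Variables (P : twosidedIdeal A) (u : A) (d : nat).
Hypotheses (Pprime : elementwise_prime P) (Phom : homogeneous_ideal P).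
Hypotheses (ud : homogeneous d u) (uP : u \notin P).
Hypothesis uC : forall x y, u * x * u * y * u - u * y * u * x * u \in P.

Lemma prime_homogeneous_between x y : x \notin P -> y \notin P ->
  exists k r, homogeneous k r /\ x * r * y \notin P.
Proof.
move=> xP yP; apply: contrapT => none.
have [r|xP'|yP'] := Pprime (x := x) (y := y); last 2 first.
- by rewrite xP' in xP.
- by rewrite yP' in yP.
rewrite [r]sum_components mulr_sumr mulr_suml rpred_sum // => k _.
apply: contrapT => /negP rkP; apply: none; exists k, (phi r)`_k.
by split=> //; apply: phi_homog.
Qed.

Lemma ideal_subl x y : x - y \in P -> y \in P -> x \in P.
Proof. by move=> xyP yP; rewrite -[x](subrK y) rpredD. Qed.

(** Commutativity rewrites [uxu r uyu] modulo [P] as [u r (u x u y u)], which lies in [P]; then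
    primeness applies. *)
Lemma corner_domain x y :
  u * x * u * y * u \in P -> u * x * u \in P \/ u * y * u \in P.
Proof.
move=> xyP; apply: Pprime => r.
have -> : u * x * u * r * (u * y * u) = u * x * u * r * u * (y * u).
  by rewrite !mulrA.
apply: (@ideal_subl _ (u * r * u * x * u * (y * u))).
  by rewrite -mulrBl idealMr.
have -> : u * r * u * x * u * (y * u) = u * r * (u * x * u * y * u).
  by rewrite !mulrA.
exact: idealMl.
Qed.

(** Primeness allows a further factor [v] of positive degree to be inserted again and again without
    falling into [P]. *)
Lemma corner_high_degree v e N : (0 < e)%N -> homogeneous e v -> v \notin P ->
  exists k w, [/\ (N <= k)%N, homogeneous k w & u * w * u \notin P].
Proof.
move=> e0 ve vP; elim: N => [|N [k [w [Nk wk uwu]]]].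
  by have [k [w [wk uwu]]] := prime_homogeneous_between uP uP; exists k, w.
have [i [r [ri ruv]]] := prime_homogeneous_between uwu vP.
have [j [s [sj ruvs]]] := prime_homogeneous_between ruv uP.
exists (k + d + i + e + j)%N, (w * u * r * v * s); split.
- by rewrite -!addnA (leq_trans _ (leq_add Nk (leqnn _))) // -addn1 leq_add2l
    addnCA addnA addnCA -addnA ltn_addr.
- by do !apply: homogeneousM.
by move: ruvs; rewrite !mulrA.
Qed.

Lemma top_component x : u * x * u \notin P ->
  exists2 k, u * (phi x)`_k * u \notin P &
    forall i, (k < i)%N -> u * (phi x)`_i * u \in P.
Proof.
move=> xP.
have ex : exists k, u * (phi x)`_k * u \notin P.
  apply: contrapT => none; case/negP: xP.
  rewrite [x]sum_components mulr_sumr mulr_suml rpred_sum // => k _.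
  by apply: contrapT => /negP kP; apply: none; exists (k : nat).
have bound k : u * (phi x)`_k * u \notin P -> (k <= size (phi x))%N.
  by apply: contraNT; rewrite -ltnNge => /ltnW /(nth_default 0) ->;
    rewrite mulr0 mul0r rpred0.
case: (ex_maxnP ex bound) => k kP kmax; exists k => // i ki.
by apply: contraTT ki => /kmax; rewrite -leqNgt.
Qed.

(* In the corner [u A u] modulo [P], a graded commutative domain for the product
   [uxu * uyu = uxuyu], the equation [Y (1 - X W) = W0] with [W] of degree
   larger than [W0] contradicts the comparison of top components. *)
Lemma corner_not_quasi_regular v e x :
  (0 < e)%N -> homogeneous e v -> v \notin P -> x \notin P ->
  exists y s, forall c, c * (1 - y * x * s) - 1 \notin P.
Proof.
move=> e0 ve vP xP.
have [k0 [w0 [w0k uw0u]]] := prime_homogeneous_between uP uP.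
have [k [w [k0k wk uwu]]] := corner_high_degree k0.+1 e0 ve vP.
have [_ [r1 [_ ur1x]]] := prime_homogeneous_between uP xP.
have [_ [r2 [_ ur1xr2u]]] := prime_homogeneous_between ur1x uP.
exists (u * r1), (r2 * u * w) => c; apply/negP => cP.
pose X := r1 * x * r2; pose Y := w0 * c.
have uXu : u * X * u \notin P by rewrite /X !mulrA.
(* The assumption on [c], multiplied by [u * w0] on the left and by [u] on the right, becomes an
   equation in the corner. *)
have eqP0 : u * Y * u - u * Y * (u * X * u * w * u) - u * w0 * u \in P.
  have := idealMr u (idealMl (u * w0) cP).
  by rewrite (mulrBr c) mulr1 !(mulrBr (u * w0)) mulr1 !mulrBl /X /Y !mulrA.
have [|I IP Imax] := @top_component Y.
  apply/negP => uYu; case/negP: uw0u.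
  apply: (ideal_subl (y := u * Y * u - u * Y * (u * X * u * w * u))).
    by rewrite -rpredN opprB.
  have -> : u * Y * (u * X * u * w * u) = u * Y * u * (X * u * w * u).
    by rewrite !mulrA.
  by rewrite rpredB // idealMr.
have [J JP Jmax] := top_component uXu.
(* In degree [m + (d + (d + k + d))] the middle term has its top component. The first term
   contributes a component of [Y] above [I], hence in [P], and the last one nothing, as [k0 < k]. *)
pose m := (I + J + d)%N.
have := Phom (m + (d + (d + k + d)))%N eqP0; rewrite !raddfB /= !coefB.
have -> : (phi (u * Y * u))`_(m + (d + (d + k + d))) =
    u * (phi Y)`_(I + J + d + d + k) * u.
  rewrite -(coef_homogeneous_sandwich _ _ ud ud); move: (phi _) => p.
  have -> : (m + (d + (d + k + d)) = I + J + d + d + k + (d + d))%N => //.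
  by rewrite /m; clear; lia.
have -> : (phi (u * w0 * u))`_(m + (d + (d + k + d))) = 0.
  rewrite (coef_homogeneous _ (homogeneousM (homogeneousM ud w0k) ud)).
  by case: eqP => //; move: k0k; rewrite /m; clear; lia.
have uwud := homogeneousM (homogeneousM ud wk) ud.
have -> : u * Y * (u * X * u * w * u) = u * (Y * u * X) * (u * w * u).
  by rewrite !mulrA.
rewrite (coef_homogeneous_sandwich _ _ ud uwud)
  (coef_homogeneous_middle _ _ _ ud).
rewrite subr0 => sumP; have {sumP} : u * (\sum_(i < (I + J).+1)
    (phi Y)`_i * u * (phi X)`_(I + J - i)) * (u * w * u) \in P.
  rewrite -[X in X \in P](subKr (u * (phi Y)`_(I + J + d + d + k) * u))
    rpredB //.
  by apply: Imax; move: k0k; clear; lia.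
have Ilt : (I < (I + J).+1)%N by rewrite ltnS leq_addr.
(* Only the term with index [I] survives: any other has either [Y] above degree [I] or [X] above
   degree [J]. *)
rewrite (bigD1 (Ordinal Ilt)) //= addKn mulrDr mulrDl => sumP.
have {sumP} : u * (phi Y)`_I * u * ((phi X)`_J * u * w) * u \in P.
  rewrite -[X in X \in P](addrK (u * (\sum_(i < (I + J).+1 | i != Ordinal Ilt)
    (phi Y)`_i * u * (phi X)`_(I + J - i)) * (u * w * u))) rpredB //.
    by move: sumP; rewrite !mulrA.
  rewrite mulr_sumr mulr_suml rpred_sum // => i iI.
  have [Ii|iI'] := ltnP I i.
    by rewrite !mulrA -!(mulrA (u * (phi Y)`_i * u)) idealMr // Imax.
  have JI : (J < I + J - i)%N.
    have: (i != I :> nat)%N by apply: contra iI => /eqP ?; apply/eqP/val_inj.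
    by move: (ltn_ord i) iI'; clear; lia.
  have -> : u * ((phi Y)`_i * u * (phi X)`_(I + J - i)) * (u * w * u) =
      u * (phi Y)`_i * (u * (phi X)`_(I + J - i) * u) * (w * u)
        by rewrite !mulrA.
  by rewrite idealMr // idealMl // Jmax.
case/corner_domain => [|h]; first exact/negP.
have {h} : u * (phi X)`_J * u * w * u \in P by move: h; rewrite !mulrA.
by case/corner_domain; apply/negP.
Qed.

End CommutingCorner.

End Graded.

(** * The projection onto the quotient ring *)

Section Quotient.

Variables (R : pzRingType) (P : twosidedIdeal R).

Local Notation pi := (\pi_(quotient_ring P) : R -> quotient_ring P).

Lemma quotient_piM x y : pi (x * y) = pi x * pi y.
Proof. by rewrite -[RHS]/(quot_mul _ _) quot_mul_pi. Qed.

Lemma quotient_piD x y : pi (x + y) = pi x + pi y.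
Proof. by rewrite quot_add_pi. Qed.

Lemma quotient_pi_eq x y : pi x = pi y <-> x - y \in P.
Proof. by rewrite -quot_piP; split=> [->|/eqP]. Qed.

Lemma quotient_pi0 : pi 0 = 0.
Proof. by apply: (addrI (pi 0)); rewrite -quotient_piD !addr0. Qed.

Lemma quotient_piB x y : pi (x - y) = pi x - pi y.
Proof. by apply/eqP; rewrite eq_sym subr_eq -quotient_piD subrK. Qed.

Lemma quotient_pi_eq0 x : pi x = 0 <-> x \in P.
Proof. by rewrite -quotient_pi0 quotient_pi_eq subr0. Qed.

Lemma quotient_pi1 : pi 1 = 1.
Proof. by []. Qed.

Lemma quotient_pi_word (a : nat -> R) w :
  pi (eval_word a w) = eval_word (fun i => pi (a i)) w.
Proof.
elim: w => [|i w IHw]; first by rewrite !eval_nil quotient_pi1.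
by rewrite !eval_cons quotient_piM IHw.
Qed.

End Quotient.

(** * Semiprimitivity for a graded algebra with Chinese generators *)

Section Assembly.

Variables (K : fieldType) (A : nzRingType) (scal : {rmorphism K -> A}).
Hypothesis scal_comm : forall c x, GRing.comm (scal c) x.

Variable phi : {rmorphism A -> {poly A}}.
Hypothesis phi1 : forall x, (phi x).[1] = x.
Hypothesis phi_homog : forall x d, homogeneous phi d (phi x)`_d.

Variables (g : nat -> A) (n : nat).
Hypothesis g_homog : forall i, homogeneous phi 1 (g i).
Hypothesis g_rel : chinese_relations g.

Hypothesis span_ind : forall Q : A -> Prop, Q 0 ->
  (forall x y, Q x -> Q y -> Q (x + y)) ->
  (forall c w, {subset w <= iota 0 n} -> Q (scal c * eval_word g w)) ->
  forall x, Q x.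

Variable P : twosidedIdeal A.

Local Notation pi := (\pi_(quotient_ring P) : A -> quotient_ring P).
Local Notation a := (fun i => pi (g i)).

Let scal_mulCA c x y : x * (scal c * y) = scal c * (x * y).
Proof. by rewrite !mulrA scal_comm. Qed.

Lemma mem_span_words x y r :
  (forall w, {subset w <= iota 0 n} -> x * eval_word g w * y \in P) ->
  x * r * y \in P.
Proof.
move=> xyP; elim/span_ind: r => [|r s rP sP|c w wn].
- by rewrite mulr0 mul0r rpred0.
- by rewrite mulrDr mulrDl rpredD.
by rewrite scal_mulCA -mulrA idealMl // xyP.
Qed.

(** Handles the degenerate case in which no generator can provide an element of positive degree
    outside [P]. *)
Lemma scalar_mod_generators : (forall i, g i \in P) ->
  forall x, exists c, x - scal c \in P.
Proof.
move=> gP x; elim/span_ind: x => [|x y [c xc] [d yd]|c w _].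
- by exists 0; rewrite rmorph0 subrr rpred0.
- by exists (c + d); rewrite rmorphD /= opprD addrACA rpredD.
case: w => [|i w]; first by exists c; rewrite eval_nil mulr1 subrr rpred0.
by exists 0; rewrite rmorph0 subr0 idealMl // eval_cons idealMr.
Qed.

Lemma quotient_prime_corner : prime_ideal P -> prime_corner a (iota 0 n) 1.
Proof.
move=> Pprime; have Pel := prime_ideal_elementwise Pprime.
split.
- by rewrite -quotient_pi1 quotient_pi_eq0; case: Pprime => /negP.
- by move=> i _; apply/commr_sym/commr1.
move=> x y _ _; rewrite -[x]reprK -[y]reprK => xyP.
rewrite !mulr1 !quotient_pi_eq0; apply: Pel => r.
apply: mem_span_words => w wn.
by rewrite -quotient_pi_eq0 !quotient_piM quotient_pi_word -[RHS](xyP w wn)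
  mulr1.
Qed.

Definition quotient_homogeneous d (x : quotient_ring P) : Prop :=
  exists2 x', homogeneous phi d x' & x = pi x'.

Lemma quotient_commuting_corner : prime_ideal P ->
  exists d u, [/\ homogeneous phi d u, u \notin P &
    forall x y, u * x * u * y * u - u * y * u * x * u \in P].
Proof.
move=> Pprime.
have rel : chinese_relations a.
  have pi3 x y t : pi x * pi y * pi t = pi (x * y * t) by rewrite !quotient_piM.
  by move=> i k j /g_rel[E1 E2]; rewrite !pi3 E1 E2.
have h1 : quotient_homogeneous 0 1.
  by exists 1; [apply: homogeneous1|].
have ha i : quotient_homogeneous 1 (a i) by exists (g i).
have hB d x y : quotient_homogeneous d x -> quotient_homogeneous d y ->
    quotient_homogeneous d (x - y).
  move=> [x' xd ->] [y' yd ->]; exists (x' - y'); first exact: homogeneousB.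
  by rewrite quotient_piB.
have hM d d' x y : quotient_homogeneous d x -> quotient_homogeneous d' y ->
    quotient_homogeneous (d + d') (x * y).
  move=> [x' xd ->] [y' yd ->]; exists (x' * y'); first exact: homogeneousM.
  by rewrite quotient_piM.
have [_ [d [[u ud ->] _ uP uC]]] := exists_commuting_corner rel h1 ha hB hM
  (iota_ltn_sorted 0 n) (quotient_prime_corner Pprime).
exists d, u; split=> //; first by apply/negP;
  rewrite -quotient_pi_eq0 -[pi u]mulr1.
(* The relation is bilinear in [x] and [y], so the case of words suffices. *)
move=> x y; elim/span_ind: x => [|x x' xP x'P|c w wn].
- by rewrite !(mulr0, mul0r) subrr rpred0.
- by rewrite !(mulrDr, mulrDl) opprD addrACA rpredD.
elim/span_ind: y => [|y y' yP y'P|c' w' wn'].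
- by rewrite !(mulr0, mul0r) subrr rpred0.
- by rewrite !(mulrDr, mulrDl) opprD addrACA rpredD.
have outl z t : u * (scal c * z) * u * (scal c' * t) * u =
    scal c * (scal c' * (u * z * u * t * u)).
  rewrite -!mulrA (scal_mulCA c u) (scal_mulCA c' u) (scal_mulCA c' z).
  by rewrite (scal_mulCA c' u).
have outr z t : u * (scal c' * t) * u * (scal c * z) * u =
    scal c * (scal c' * (u * t * u * z * u)).
  rewrite -!mulrA (scal_mulCA c' u) (scal_mulCA c u) (scal_mulCA c t).
  by rewrite (scal_mulCA c u) (scal_mulCA c (scal c')).
rewrite outl outr -!mulrBr !idealMl // -quotient_pi_eq.
by rewrite !quotient_piM !quotient_pi_word -[LHS]mulr1 uC // mulr1.
Qed.

Theorem minimal_prime_quotient_semiprimitive :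
  minimal_prime_ideal P -> semiprimitive (quotient_ring P).
Proof.
move=> Pmin x Jx; apply: contrapT; rewrite -[x]reprK in Jx *.
rewrite quotient_pi_eq0 => /negP xP.
have Phom := minimal_prime_homogeneous phi1 phi_homog Pmin.
have Pprime := Pmin.1; have Pel := prime_ideal_elementwise Pprime.
suff [y [s ysP]] : exists y s, forall c, c * (1 - y * repr x * s) - 1 \notin P.
  have [c cE] := jacobson_radical_left_inverse (pi y) (pi s) Jx.
  have /quotient_pi_eq cP : pi (repr c * (1 - y * repr x * s)) = pi 1.
    by rewrite quotient_piM quotient_piB !quotient_piM quotient_pi1 reprK.
  by move: (ysP (repr c)); rewrite cP.
have [d [u [ud uP uC]]] := quotient_commuting_corner Pprime.
have [/scalar_mod_generators gP|/existsNP[i /negP giP]] := pselect (forall i,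
  g i \in P).
  have [c xc] := gP (repr x).
  have c0 : c != 0.
    by apply: contraNneq xP => c0; move: xc; rewrite c0 rmorph0 subr0.
  (* Modulo [P] the element [repr x] is the nonzero scalar [c], so [1 - c^-1 x] lies in [P] and has
     no left inverse. *)
  exists (scal c^-1), 1 => b; apply/negP => bP; case/negP: (Pprime.1).
  have: b * (scal c^-1 * (repr x - scal c)) \in P by rewrite !idealMl.
  rewrite (mulrBr (scal c^-1)) -rmorphM mulVf // rmorph1 => xcP.
  rewrite mulr1 in bP.
  have := rpredD bP xcP; rewrite addrAC -mulrDr -(opprB _ 1) addNr mulr0 sub0r.
  by rewrite rpredN.
have [y [s ysP]] := corner_not_quasi_regular phi1 phi_homog Pel Phom ud uP uC
  (isT : 0 < 1)%N (g_homog i) giP xP.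
by exists y, s.
Qed.

End Assembly.

(** * The Chinese algebra *)

Lemma mul3_eq0 (R : pzRingType) (x y z : R) : [\/ x = 0, y = 0 | z = 0] ->
  x * y * z = x * z * y /\ x * z * y = z * x * y.
Proof. by case=> ->; rewrite !(mulr0, mul0r). Qed.

Section ChineseGrading.

Variables (K : fieldType) (n : nat).

Local Notation M := (chinese_monoid n).
Local Notation A := {malg K[M]}.

Definition chinese_length (x : M) : nat := size (repr x).

Lemma chinese_length_pi u : chinese_length (\pi u) = size u.
Proof. exact: chinese_cong_size (chinese_repr_pi u). Qed.

Lemma chinese_lengthM (x y : M) :
  chinese_length (mmul x y) = (chinese_length x + chinese_length y)%N.
Proof. by rewrite [LHS]chinese_length_pi size_cat. Qed.

Lemma mmul_pi (u v : seq 'I_n) :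
  mmul (\pi_M u : M) (\pi_M v : M) = \pi_M (u ++ v).
Proof. exact: chinese_mul_pi. Qed.

Lemma monomialM (c d : K) (x y : M) :
  << c *g x >> * << d *g y >> = << c * d *g mmul x y >> :> A.
Proof. by rewrite malgM_def fgmulUU. Qed.

Definition graded_monomial (x : M) : {poly A} :=
  (<< x >> : A)%:P * 'X^(chinese_length x).

Fact graded_monomial_is_mmorphism : mmorphism graded_monomial.
Proof.
split=> [x y|].
  by rewrite /graded_monomial chinese_lengthM mul_monomials monomialM mulr1.
by rewrite /graded_monomial chinese_length_pi expr0 mulr1.
Qed.

HB.instance Definition _ :=
  monalg.isMultiplicative.Build M {poly A} graded_monomial
    graded_monomial_is_mmorphism.

(** The linear extension of [x] to [x 'X^(length x)]: the grading by word length, well defined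
    because the relations preserve length. *)
Definition coaction : A -> {poly A} :=
  mmap (polyC \o @malgC M K) graded_monomial.

HB.instance Definition _ := GRing.Additive.on coaction.

Lemma malgC_comm (c : K) (x : A) : GRing.comm c%:MP x.
Proof.
rewrite /GRing.comm [x]monalgE mulr_sumr mulr_suml; apply: eq_bigr => k _.
by rewrite !monomialM mulm1 mul1m mulrC.
Qed.

Fact coaction_is_multiplicative : multiplicative coaction.
Proof.
apply: commr_mmap_is_multiplicative => x m m' /=.
rewrite /graded_monomial; apply: commrM; last exact: commr_polyXn.
by rewrite /GRing.comm -!polyCM malgC_comm.
Qed.

HB.instance Definition _ :=
  GRing.isMultiplicative.Build A {poly A} coaction coaction_is_multiplicative.

Lemma coactionU (c : K) (x : M) :
  coaction << c *g x >> = (<< c *g x >> : A)%:P * 'X^(chinese_length x).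
Proof.
by rewrite /coaction mmapU /= /graded_monomial mulrA -polyCM monomialM mulr1
  mul1m.
Qed.

Lemma coaction1 (x : A) : (coaction x).[1] = x.
Proof.
rewrite {1}[x]monalgE raddf_sum horner_sum /= [RHS]monalgE.
by apply: eq_bigr => k _; rewrite coactionU hornerCM hornerXn expr1n mulr1.
Qed.

Lemma coaction_homogeneous (x : A) d : homogeneous coaction d (coaction x)`_d.
Proof.
rewrite /homogeneous {1 2}[x]monalgE raddf_sum /= coef_sum.
rewrite raddf_sum rmorph_sum mulr_suml /=; apply: eq_bigr => k _.
rewrite coactionU coefCM coefXn; case: eqP => [->|_].
  by rewrite mulr1 coactionU.
by rewrite mulr0 raddf0 mul0r.
Qed.

Definition word_monomial (w : seq 'I_n) : A := << (\pi_M w : M) >>.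

Lemma word_monomial_cat u v :
  word_monomial u * word_monomial v = word_monomial (u ++ v).
Proof. by rewrite /word_monomial monomialM mulr1 mmul_pi. Qed.

Lemma word_monomial_cong u v :
  chinese_cong u v -> word_monomial u = word_monomial v.
Proof. by move=> uv; congr mkmalgU; apply/eqP/chinese_piP. Qed.

(* Letters beyond [n] are sent to [0], which respects the Chinese relations. *)
Definition generator (i : nat) : A :=
  if insub i is Some j then word_monomial [:: j] else 0.

Lemma generatorP i : generator i = 0 \/
  exists2 j : 'I_n, i = j & generator i = word_monomial [:: j].
Proof.
by rewrite /generator; case: insubP => [j _ jE|_]; [right; exists j|left].
Qed.

Lemma homogeneous_generator i : homogeneous coaction 1 (generator i).
Proof.
rewrite /homogeneous /generator /=; case: insubP => [j _ _|_].
  by rewrite /word_monomial coactionU chinese_length_pi.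
by rewrite raddf0 mul0r.
Qed.

Lemma generator_rel : chinese_relations generator.
Proof.
move=> i k j /andP[ik kj].
have [j0|[j' j'E jE]] := generatorP j; first by apply: mul3_eq0; constructor 1.
have [i0|[i' i'E iE]] := generatorP i; first by apply: mul3_eq0; constructor 2.
have [k0|[k' k'E kE]] := generatorP k; first by apply: mul3_eq0; constructor 3.
rewrite iE jE kE; rewrite i'E k'E j'E in ik kj.
rewrite !word_monomial_cat; split; apply: word_monomial_cong.
  exact: chinese_jik_jki.
exact: chinese_jki_kji.
Qed.

Lemma word_monomialE (w : seq 'I_n) :
  word_monomial w = eval_word generator [seq val i | i <- w].
Proof.
elim: w => [|i w IHw]; first by rewrite eval_nil.
by rewrite /= eval_cons -IHw /generator valK word_monomial_cat.
Qed.

Lemma chinese_algebra_ind (Q : A -> Prop) :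
  Q 0 -> (forall x y, Q x -> Q y -> Q (x + y)) ->
  (forall c w, {subset w <= iota 0 n} -> Q (c%:MP * eval_word generator w)) ->
  forall x, Q x.
Proof.
move=> Q0 QD QW x; rewrite [x]monalgE.
elim/big_rec: _ => [//|k y _ Qy]; apply: QD => //.
have -> : << x@_k *g k >> = (x@_k)%:MP * word_monomial (repr k) :> A.
  by rewrite /word_monomial reprK monomialM mulr1 mul1m.
rewrite word_monomialE; apply: QW => i /mapP[j _ ->].
by rewrite mem_iota ltn_ord.
Qed.

End ChineseGrading.

Theorem theorem3p1p1 (K : fieldType) (n : nat) (hn : (1 <= n)%N)
    (P : twosidedIdeal (chinese_algebra K n)) :
  minimal_prime_ideal P -> semiprimitive (quotient_ring P).
Proof.
exact: (minimal_prime_quotient_semiprimitive (@malgC_comm K n) (@coaction1 K n)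
  (@coaction_homogeneous K n) (@homogeneous_generator K n)
  (@generator_rel K n) (@chinese_algebra_ind K n)).
Qed.
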